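(* Let $G$ be a minimal non-weakly flat path extendable graph with no even hole and no sector wheel. Then $G$ has no star cutset.
   Context: All graphs are finite and simple. A hole is an induced cycle with at least four vertices; even if it has an even number of vertices. A graph is chordal if it has no hole. A wheel $(H,w)$ consists of a hole $H$ and a vertex $w\notin V(H)$ with at least three neighbors in $V(H)$; it is universal if $w$ is adjacent to all of $V(H)$; a sector wheel is a wheel that is universal or such that $N(w)\cap V(H)$ induces a path. $G$ has a star cutset if $G$ is connected and there exist a vertex $v$ and $C\subseteq N[v]$ with $v\in C$ such that $G\setminus C$ is disconnected. For a path $P$, $N[P]$ is the set of vertices in $P$ or with a neighbor in $P$. A graph $G$ is weakly flat path extendable (weakly FPE) if for every path $P$ with one or two vertices and every two sets $W_1,W_2$ with $G[W_1],G[W_2]$ chordal, $W_1\cap W_2=V(P)$, $W_1\cup W_2=N[P]$, there exist $X_1\supseteq W_1$, $X_2\supseteq W_2$ with $G[X_1],G[X_2]$ chordal, $X_1\cap X_2=V(P)$, $X_1\cup X_2=V(G)$. $G$ is minimal non-weakly FPE if $G$ is not weakly FPE but every proper induced subgraph of $G$ is weakly FPE. *)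

(* Defs.v *)
From mathcomp Require Import all_boot.

Set Implicit Arguments.
Unset Strict Implicit.
Unset Printing Implicit Defensive.

Record sgraph := SGraph {
  vertex :> finType;
  adj : rel vertex;
  adj_sym : symmetric adj;
  adj_irrefl : irreflexive adj
}.

Notation "x -- y" := (adj x y) (at level 30).

Section Induced.
Variables (G : sgraph) (S : {set G}).

Definition induced_adj : rel {x : G | x \in S} := fun u v => val u -- val v.

Lemma induced_adj_sym : symmetric induced_adj.
Proof. by move=> u v; apply: adj_sym. Qed.

Lemma induced_adj_irrefl : irreflexive induced_adj.
Proof. by move=> u; apply: adj_irrefl. Qed.

Definition induced : sgraph := SGraph induced_adj_sym induced_adj_irrefl.

End Induced.

Section Graph.
Variable G : sgraph.
Implicit Types (v w : G) (p c : seq G) (C S W X : {set G}).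

(* [p] lists, in order, the vertices of an induced path; on one or two
   vertices every path is induced. *)
Definition is_path p : Prop :=
  [/\ p != [::], uniq p &
      {in p &, forall x y,
        x -- y = (index y p == (index x p).+1) || (index x p == (index y p).+1)}].

(* [c] lists the vertices of the hole in cyclic order. *)
Definition is_hole c : Prop :=
  [/\ 3 < size c, uniq c &
      {in c &, forall x y, x -- y = (y == next c x) || (x == next c y)}].

Definition nbrs v : {set G} := [set x | v -- x].

Definition closed_nbrs v : {set G} := v |: nbrs v.

Definition path_nbhd p : {set G} :=
  [set x | (x \in p) || [exists y, (y \in p) && x -- y]].

Definition chordal : Prop := forall c, ~ is_hole c.

Definition even_hole_free : Prop := forall c, is_hole c -> odd (size c).

Definition is_wheel c w : Prop :=
  [/\ is_hole c, w \notin c & 3 <= #|nbrs w :&: [set x in c]|].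

Definition universal_wheel c w : Prop :=
  is_wheel c w /\ {in c, forall x, w -- x}.

Definition sector_wheel c w : Prop :=
  is_wheel c w /\
  (universal_wheel c w \/
   exists p, is_path p /\ nbrs w :&: [set x in c] = [set x in p]).

Definition sector_wheel_free : Prop := forall c w, ~ sector_wheel c w.

(* The graph without vertices counts as connected, so that deleting all the
   vertices of a graph does not disconnect it. *)
Definition connected_graph : Prop := forall x y : G, connect (@adj G) x y.

End Graph.

Definition has_star_cutset (G : sgraph) : Prop :=
  connected_graph G /\
  exists (v : G) (C : {set G}),
    [/\ v \in C, C \subset closed_nbrs v & ~ connected_graph (induced (~: C))].

Definition weakly_FPE (G : sgraph) : Prop :=
  forall (p : seq G) (W1 W2 : {set G}),
    is_path p -> (size p = 1 \/ size p = 2) ->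
    chordal (induced W1) -> chordal (induced W2) ->
    W1 :&: W2 = [set x in p] -> W1 :|: W2 = path_nbhd p ->
    exists X1 X2 : {set G},
      [/\ W1 \subset X1 /\ W2 \subset X2,
          chordal (induced X1), chordal (induced X2),
          X1 :&: X2 = [set x in p] & X1 :|: X2 = [set: G]].

Definition minimal_non_weakly_FPE (G : sgraph) : Prop :=
  ~ weakly_FPE G /\
  forall S : {set G}, S \proper [set: G] -> weakly_FPE (induced S).

(* Main.v *)
(** Call a partition of N[P] into W1, W2 extendable if it extends to a partition
of the whole graph as in the definition of weakly FPE.  In a graph with no even
hole and no sector wheel, N[Q] is chordal whenever Q is a vertex or an edge, so
that any partition of N[Q] may be prescribed.  If B is a union of components of
G - N[Q], with P outside of B and no vertex of P outside of Q having a neighbor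
in B, then one extends first to G - B from P, then into B from Q; the two
partitions can be glued because an arc of a hole through B, closed up through
Q, would be a hole on the side of B.  So P is extendable in all such cases.

Let v be the center of a star cutset.  If G - N[v] is connected, some b <> v has
N[b] inside N[v]; then b lies on no hole and can be added back to a partition of
G - b.  Otherwise G - N[v] splits into two anticomplete parts B1, B2, and the
gluing above, with Q = v, Q = P or Q an edge at v, handles every P except an
edge pq inside N(v), and in that case it provides:
- an induced path z1 ... zk in N(v) - N[P] from N(B1) to N(B2),
- paths from z1 to p and from zk to p and q, inside B1, B2 and B2, avoiding the
  neighbors of the other end of pq.
The holes closed by v show that the interiors of the last three paths have even
size; then the holes p B1 z1 ... zk B2 p and p B1 z1 ... zk B2 q p have lengths
of different parities. *)
Require Import Defs.
From mathcomp Require Import all_boot zify.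

Set Implicit Arguments.
Unset Strict Implicit.
Unset Printing Implicit Defensive.

(** * Splitting a sequence at the first or last element satisfying a predicate *)

Section Sequences.
Variables (T : eqType) (a : pred T).

Lemma has_splitl (s : seq T) : has a s ->
  exists s1 x s2, [/\ s = s1 ++ x :: s2, a x & ~~ has a s1].
Proof.
elim: s => //= y s IH; case: (boolP (a y)) => [ay _ | nay /= /IH].
  by exists [::], y, s.
by case=> s1 [x [s2 [-> ax n1]]]; exists (y :: s1), x, s2; rewrite /= negb_or nay.
Qed.

Lemma has_splitr (s : seq T) : has a s ->
  exists s1 x s2, [/\ s = s1 ++ x :: s2, a x & ~~ has a s2].
Proof.
elim: s => //= y s IH; case: (boolP (has a s)) => [/IH | nas].
  by case=> s1 [x [s2 [-> ax n1]]]; exists (y :: s1), x, s2.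
by rewrite orbF => ay; exists [::], y, s.
Qed.

End Sequences.

(** * Induced paths and holes as sequences *)

Section InducedPaths.
Variable G : sgraph.
Implicit Types (x y z u v w : G) (s t c h : seq G) (S E B : {set G}).

(** The recursive boolean counterpart of [is_path], suited to cutting and concatenating; unlike
    [is_path] it accepts the empty sequence. *)
Fixpoint ipath s : bool :=
  if s is x :: t then
    if t is y :: t' then
      [&& x -- y, x \notin t, all (fun z => ~~ (x -- z)) t' & ipath t]
    else true
  else true.

Lemma adj_neq x y : x -- y -> x != y.
Proof. by apply: contraTneq => ->; rewrite adj_irrefl. Qed.

Lemma ipath_behead x s : ipath (x :: s) -> ipath s.
Proof. by case: s => // y s /and4P[]. Qed.

Lemma ipath_catr s t : ipath (s ++ t) -> ipath t.
Proof. by elim: s => // x s IH /ipath_behead. Qed.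

Lemma ipath_catl s t : ipath (s ++ t) -> ipath s.
Proof.
elim: s => // x [|y s] //= IH /and4P[-> + + /IH ->].
by rewrite !inE mem_cat all_cat !negb_or => /and3P[-> -> _] /andP[-> _].
Qed.

Lemma ipath_uniq s : ipath s -> uniq s.
Proof. by elim: s => // x [|y s] // IH /and4P[_ nx _ /IH us]; rewrite cons_uniq nx. Qed.

Lemma ipath_nth x0 s : ipath s <->
  uniq s /\ forall i j, i < j < size s ->
    (nth x0 s i -- nth x0 s j) = (j == i.+1).
Proof.
elim: s => [|x s IH]; first by split=> // _; split=> // i j; rewrite ltn0 andbF.
split=> [ip | [/andP[nx us] adjE]].
  split=> [|i j]; first exact: ipath_uniq.
  have [us adjE] := (IH.1 (ipath_behead ip)).
  case: j => [|j]; first by rewrite ltn0.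
  case: i => [|i] /=; rewrite !ltnS; last by move=> ij; rewrite adjE.
  case: s ip {IH us adjE} => // y s /and4P[xy _ xs _] lt_j.
  case: j lt_j => [|j] /= lt_j; first by rewrite xy.
  by apply/negbTE/(allP xs)/mem_nth.
have /IH : uniq s /\ forall i j, i < j < size s -> nth x0 s i -- nth x0 s j = (j == i.+1).
  by split=> // i j ij; have := adjE i.+1 j.+1; rewrite /= !ltnS eqSS; apply.
case: s nx us adjE {IH} => // y s nx us adjE ips.
apply/and4P; split=> //.
  by have := adjE 0 1; apply.
apply/(all_nthP x0) => i lt_i.
by have /= -> := adjE 0 i.+2; rewrite ?ltnS.
Qed.

(** Two induced paths are glued at the common vertex [x], so only the pairs between [s] and [t]
    remain to be controlled. *)
Lemma ipath_cat s x t : ipath (rcons s x) -> ipath (x :: t) ->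
  {in s & t, forall y z, (y != z) && ~~ (y -- z)} -> ipath (s ++ x :: t).
Proof.
elim: s => // y s IH ipl ipr anti.
have ips : ipath (s ++ x :: t).
  apply: IH => //; first exact: ipath_behead ipl.
  by move=> u v us; apply: anti; rewrite inE us orbT.
have yt z : z \in t -> (y != z) && ~~ (y -- z) by apply: anti; rewrite inE eqxx.
case: s ips ipl {IH anti} => [|z s] /= ips.
  case/and3P => yx nyx _; rewrite yx ips !andbT /=.
  rewrite inE negb_or -[y == x]/(y == x) (adj_neq yx) /=.
  apply/andP; split; first by apply/negP => /yt; rewrite eqxx.
  by apply/allP => z /yt /andP[].
case/and4P => -> + + _; rewrite ips andbT /= => ny all_y.
rewrite inE mem_rcons inE in ny; rewrite all_rcons in all_y.
case/andP: all_y => nyx all_y; rewrite all_cat all_y /= nyx /=.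
rewrite inE mem_cat inE !negb_or.
move: ny; rewrite !negb_or => /and3P[-> -> ->] /=.
by apply/andP; split; [apply/negP => /yt; rewrite eqxx | apply/allP => u /yt /andP[]].
Qed.

Lemma is_hole_nth x0 c : is_hole c <-> [/\ 3 < size c, uniq c &
  forall i j, i < j < size c -> (nth x0 c i -- nth x0 c j) =
    (j == i.+1) || (i == 0) && (j.+1 == size c)].
Proof.
(* The [if] is the successor modulo [size c]: the last position is followed by 0. *)
have nextE i : 3 < size c -> uniq c -> i < size c ->
    next c (nth x0 c i) = nth x0 c (if i.+1 == size c then 0 else i.+1).
  case: c => // v s _ us lt_i.
  rewrite next_nth mem_nth // index_uniq //.
  case: eqP => [[eq_i] | /eqP ne_i]; first by rewrite nth_default // eq_i.
  by rewrite (set_nth_default x0) //; rewrite /= eqSS in ne_i; rewrite ltn_neqAle ne_i -ltnS.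
have ltS i : i < size c -> (if i.+1 == size c then 0 else i.+1) < size c.
  by case: eqP => [<- | /eqP ne lt_i] //; rewrite ltn_neqAle ne.
split=> [] [c3 uc adjE]; split=> //.
  move=> i j ij; have [lt_i lt_j] : i < size c /\ j < size c by lia.
  rewrite adjE ?mem_nth // !nextE // !nth_uniq ?ltS //.
  by do 2!case: (_ =P size c) => ?; lia.
move=> x y /(nthP x0)[i lt_i <-] /(nthP x0)[j lt_j <-].
rewrite !nextE // !nth_uniq ?ltS //.
have [lt_ij|lt_ji|->] := ltngtP i j.
- by rewrite adjE ?lt_ij ?lt_ji //=; move: (size c) lt_i lt_j => n ? ?; do 2!case: (_ =P n) => ?; lia.
- by rewrite adj_sym adjE ?lt_ij ?lt_ji //=; move: (size c) lt_i lt_j => n ? ?; do 2!case: (_ =P n) => ?; lia.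
- by rewrite adj_irrefl; move: (size c) lt_j c3 => n ? ?; case: (_ =P n) => ?; lia.
Qed.

(** Holes are opened and closed at one vertex in this form, which reduces claims about them to
    induced paths. *)
Lemma is_hole_cons v s : is_hole (v :: s) <-> [/\ 2 < size s, v \notin s, ipath s &
  {in s, forall x, (v -- x) = (x == head v s) || (x == last v s)}].
Proof.
split=> [/(is_hole_nth v)[/= s3 /andP[nv us] adjE] | [s3 nv ips vE]].
  split=> //.
    apply/(ipath_nth v); split=> // i j ij; have /= -> := adjE i.+1 j.+1.
      by rewrite orbF eqSS.
    by rewrite !ltnS.
  move=> x /(nthP v)[i lt_i <-]; have s0 : 0 < size s by case: (size s) s3.
  rewrite -nth0 -nth_last !nth_uniq ?prednK //.
  have /= -> := adjE 0 i.+1; last by rewrite ltnS.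
  by case: (size s) s0 => // n _; rewrite !eqSS.
have [us adjE] := ((ipath_nth v s).1 ips).
have s0 : 0 < size s by case: (size s) s3.
apply/(is_hole_nth v); split=> //=; first by rewrite nv.
case=> [|i] [|j] //=; rewrite !ltnS; last by move=> ij; rewrite adjE // orbF eqSS.
move=> lt_j; rewrite vE ?mem_nth // -nth0 -nth_last !nth_uniq ?prednK //.
by case: (size s) s0 => // n _; rewrite !eqSS.
Qed.

Lemma hole_rot n c : is_hole c -> is_hole (rot n c).
Proof.
case=> c3 uc adjE; split; rewrite ?size_rot ?rot_uniq //.
by move=> x y; rewrite !mem_rot => xc yc; rewrite adjE // !next_rot.
Qed.

Lemma hole_cycle c : is_hole c -> cycle (@adj G) c.
Proof.
case=> c3 uc adjE; apply: cycle_from_next => // x xc.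
by rewrite adjE ?mem_next // eqxx.
Qed.

Lemma ipath_is_path s : s != [::] -> ipath s -> is_path s.
Proof.
case: s => // x0 s _ ip; have [us adjE] := ((ipath_nth x0 _).1 ip).
split=> // x y /(nthP x0)[i lt_i <-] /(nthP x0)[j lt_j <-].
rewrite !index_uniq //.
have [lt_ij|lt_ji|->] := ltngtP i j.
- by rewrite adjE ?lt_ij //; lia.
- by rewrite adj_sym adjE ?lt_ji //; lia.
- by rewrite adj_irrefl; lia.
Qed.

(** The rest of the walk is shortened first, by induction; then [x] jumps to the last vertex there
    that equals [x] or is adjacent to [x]. *)
Lemma walk_ipath x s : path (@adj G) x s ->
  exists t, [/\ ipath (x :: t), last x t = last x s & {subset t <= s}].
Proof.
elim: s x => [|y s IH] x /=; first by exists [::].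
case/andP=> xy /IH[t [ipt lt ts]].
have : has (fun z => (z == x) || x -- z) (y :: t) by rewrite /= xy orbT.
case/has_splitr => t1 [z [t2 [et zx /hasPn nt2]]].
have ipz : ipath (z :: t2) by apply: (@ipath_catr t1); rewrite -et.
have t2s : {subset z :: t2 <= y :: s}.
  move=> u ut2; have : u \in y :: t by rewrite et mem_cat ut2 orbT.
  by rewrite !inE => /predU1P[->|/ts ->]; rewrite ?eqxx ?orbT.
have lz : last z t2 = last y s by rewrite -lt -[last y t]/(last x (y :: t)) et last_cat.
case/orP: zx => [/eqP zx | xz].
  by exists t2; rewrite -zx; split=> // u ut; apply: t2s; rewrite inE ut orbT.
exists (z :: t2); split=> //.
apply/and4P; split=> //; last by apply/allP => u /nt2; rewrite negb_or => /andP[].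
rewrite inE negb_or (adj_neq xz) /=.
by apply/negP => /nt2; rewrite eqxx.
Qed.

(** * Arcs of holes *)

Definition touches E x := [exists y in E, x -- y].

Lemma touchesP E x : reflect (exists2 y, y \in E & x -- y) (touches E x).
Proof. exact: exists_inP. Qed.

(** From [e] the hole is followed both ways to the first vertices outside [E]. If there are none, or
    they coincide or are consecutive on the far side, the hole is exhausted; otherwise some vertex
    beyond them is left out, and the arc between them is induced. *)
Lemma hole_arc c E e : is_hole c -> e \in c -> e \in E ->
  (forall x, x \in c -> (x \in E) || touches E x) \/
  exists z s z', [/\ ipath (z :: rcons s z'), s != [::],
    {subset z :: rcons s z' <= c}, {subset s <= E} &
    [&& z \notin E, touches E z, z' \notin E & touches E z']].
Proof.
move=> hc ec eE; case: (rot_to ec) => i h def_h.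
have hh : is_hole (e :: h) by rewrite -def_h; apply: hole_rot.
have ch x : (x \in c) = (x \in e :: h) by rewrite -def_h mem_rot.
have := hole_cycle hh; rewrite /cycle => cyc.
pose out := [pred x | x \notin E].
have notout s : ~~ has out s -> {subset s <= E}.
  by move/hasPn => ns x /ns /negPn.
have in_arc t x : {subset t <= E} -> x \in e :: t -> x \in E.
  by move=> tE; rewrite inE => /predU1P[->|/tE].
case: (boolP (has out h)) => [/has_splitl[t1 [z [h' [eh zE /notout t1E]]]] | /notout hE]; last first.
  by left=> x; rewrite ch => xh; rewrite (in_arc h).
have tz : touches E z.
  apply/touchesP; exists (last e t1); first by apply: (in_arc t1) => //; apply: mem_last.
  by move: cyc; rewrite eh rcons_cat cat_path /= adj_sym => /and3P[].
case: (boolP (has out h')) => [/has_splitr[m [z' [t2 [eh' zE' /notout t2E]]]] | /notout hE]; last first.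
  left=> x; rewrite ch eh inE mem_cat inE => /or4P[/eqP->|/t1E->|/eqP->|/hE->] //.
    by rewrite eE.
  by rewrite tz orbT.
have tz' : touches E z'.
  apply/touchesP; exists (head e t2).
    by case: (t2) t2E => [|y t] //= tE; apply: tE; rewrite inE eqxx.
  move: cyc; rewrite eh eh' rcons_cat cat_path /= rcons_cat cat_path /=.
  by case/and5P => _ _ _ _; case: (t2) => [|y t] /= /andP[].
case: m eh' => [|m1 m] eh'.
  left=> x; rewrite ch eh eh' cat0s !(inE, mem_cat).
  case/orP => [/eqP->|/orP[/t1E->|/or3P[/eqP->|/eqP->|/t2E->]]] //.
  - by rewrite eE.
  - by rewrite tz orbT.
  - by rewrite tz' orbT.
right; exists z', (t2 ++ e :: t1), z; move: zE zE' => /= -> ->; rewrite tz tz'; split=> //.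
(* The hole is rotated to start at [m1]; removing [m1] leaves an induced path that ends with the
   arc. *)
- have := hole_rot (size (e :: rcons t1 z)) hh.
  have -> : e :: h = (e :: rcons t1 z) ++ (m1 :: m ++ z' :: t2).
    by rewrite eh eh' /= cat_rcons.
  have -> : rot (size (e :: rcons t1 z)) ((e :: rcons t1 z) ++ (m1 :: m ++ z' :: t2)) =
      m1 :: (m ++ z' :: rcons (t2 ++ e :: t1) z).
    by rewrite rot_size_cat rcons_cat /= -catA.
  by case/is_hole_cons=> _ _ /ipath_catr.
- by case: (t2).
- move=> x; rewrite ch eh eh' !(inE, mem_rcons, mem_cat).
  by case/orP => [->|/orP[->|/or3P[->|->|->]]]; rewrite ?orbT.
- by move=> x; rewrite mem_cat => /orP[/t2E|/(in_arc t1)->].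
Qed.

(** * Neighborhoods of vertices and edges, and closing arcs through them *)

Lemma in_closed_nbrs v x : (x \in closed_nbrs v) = (x == v) || (v -- x).
Proof. by rewrite !inE. Qed.

(** A path with one or two vertices is encoded by the pair of its ends, which coincide for a single
    vertex. *)
Definition eq_or_adj u w := (u == w) || (u -- w).

Definition edge_nbhd u w : {set G} := closed_nbrs u :|: closed_nbrs w.

Lemma in_edge_nbhd u w x :
  (x \in edge_nbhd u w) = [|| x == u, u -- x, x == w | w -- x].
Proof. by rewrite inE !in_closed_nbrs -orbA. Qed.

Lemma eq_or_adjC u w : eq_or_adj u w = eq_or_adj w u.
Proof. by rewrite /eq_or_adj eq_sym adj_sym. Qed.

Lemma edge_nbhdC u w : edge_nbhd u w = edge_nbhd w u.
Proof. exact: setUC. Qed.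

Lemma touches_edge u w E x : [disjoint E & edge_nbhd u w] -> touches E x ->
  (x != u) && (x != w).
Proof.
move=> dE /touchesP[y yE xy]; have := disjointFr dE yE.
rewrite in_edge_nbhd; apply: contraFT; rewrite negb_and !negbK.
by case/orP => /eqP <-; rewrite xy ?orbT.
Qed.

Lemma ipath_ends z s z' : ipath (z :: rcons s z') -> s != [::] ->
  (z != z') && ~~ (z -- z').
Proof.
case: s => // y s /and4P[_ + + _] _.
by rewrite inE mem_rcons inE all_rcons !negb_or => /and3P[_ -> _] /andP[-> _].
Qed.

Lemma hole_of_arc u z s z' : ipath (z :: rcons s z') -> s != [::] ->
  u \notin z :: rcons s z' -> u -- z -> u -- z' ->
  {in s, forall x, ~~ (u -- x)} -> is_hole (u :: z :: rcons s z').
Proof.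
move=> ip s0 nu uz uz' us; apply/is_hole_cons; split=> //.
  by rewrite /= size_rcons; case: (s) s0.
have uniq_s := ipath_uniq ip.
move=> x; rewrite /= last_rcons.
rewrite inE mem_rcons inE => /or3P[/eqP->|/eqP->|xs]; rewrite ?eqxx ?orbT //.
rewrite (negbTE (us x xs)); symmetry; apply/norP; split.
  by apply: contraTneq uniq_s => <-; rewrite /= mem_rcons inE xs orbT.
by apply: contraTneq uniq_s => <-; rewrite /= rcons_uniq xs andbF.
Qed.

(* The ends of an arc of the hole in E are closed up through u and w. *)
Lemma hole_through u w c E e : eq_or_adj u w -> is_hole c ->
    e \in c -> e \in E -> [disjoint E & edge_nbhd u w] ->
    {in E & c, forall x y, x -- y -> (y \in E) || (y \in edge_nbhd u w)} ->
  exists2 d, is_hole d & {in d, forall x,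
    (x \in [set u; w]) || (x \in c) && ((x \in E) || touches E x)}.
Proof.
move=> uw hc ec eE dE clE.
case: (hole_arc hc ec eE) => [small | [z [s [z' [ip s0 sub sE /and4P[zE tz zE' tz']]]]]].
  by exists c => // x xc; rewrite xc small // orbT.
have zc : z \in c by apply: sub; rewrite inE eqxx.
have zc' : z' \in c by apply: sub; rewrite inE mem_rcons inE eqxx orbT.
have toQ y : y \in c -> y \notin E -> touches E y ->
    [/\ y != u, y != w & (u -- y) || (w -- y)].
  move=> yc yE ty; have /andP[yu yw] := touches_edge dE ty.
  have /touchesP[x xE yx] := ty.
  have := clE x y xE yc; rewrite adj_sym => /(_ yx).
  by rewrite (negbTE yE) in_edge_nbhd (negbTE yu) (negbTE yw).
have [zu zw adjz] := toQ _ zc zE tz; have [zu' zw' adjz'] := toQ _ zc' zE' tz'.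
have sN x : x \in s -> [/\ x != u, x != w, ~~ (u -- x) & ~~ (w -- x)].
  move=> /sE xE; have := disjointFr dE xE.
  by rewrite in_edge_nbhd => /negbT; rewrite !negb_or => /and4P[].
have arcP x : x \in z :: rcons s z' -> (x \in c) && ((x \in E) || touches E x).
  move=> xs; rewrite sub //=; move: xs; rewrite inE mem_rcons inE.
  by case/or3P=> [/eqP->|/eqP->|/sE->] //; rewrite ?tz ?tz' orbT.
have [us ws] : u \notin z :: rcons s z' /\ w \notin z :: rcons s z'.
  rewrite !inE !mem_rcons !inE !negb_or [u == _]eq_sym [w == _]eq_sym.
  rewrite [u == z']eq_sym [w == z']eq_sym zu zw zu' zw' /=.
  by split; apply/negP => /sN[]; rewrite eqxx.
(* The arc is closed by an edge [a b] when [a] sees only the end [z] and [b] only the end [z']. *)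
have two a b : {in s, forall x, ~~ (a -- x)} -> {in s, forall x, ~~ (b -- x)} ->
    a \notin z :: rcons s z' -> b \notin z :: rcons s z' -> a -- b ->
    a -- z -> ~~ (a -- z') -> b -- z' -> ~~ (b -- z) ->
    is_hole (b :: a :: z :: rcons s z').
  move=> asN bsN na nb ab az az' bz' bz.
  have ip' : ipath (a :: rcons (z :: s) z').
    apply/and4P; split=> //; rewrite all_rcons az' /=.
    by apply/allP.
  apply: (hole_of_arc ip') => //; first by rewrite inE negb_or eq_sym (adj_neq ab).
    by rewrite adj_sym.
  by move=> x; rewrite inE => /predU1P[->|/bsN].
have inQ (d : seq G) : {subset d <= [:: u, w & z :: rcons s z']} ->
    {in d, forall x, (x \in [set u; w]) || (x \in c) && ((x \in E) || touches E x)}.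
  move=> dsub x /dsub; rewrite 2!inE => /or3P[xu|xw|/arcP->]; rewrite ?orbT //.
    by rewrite !inE xu.
  by rewrite !inE xw orbT.
have subu (a : G) (t : seq G) : a \in [:: u; w] ->
   {subset t <= [:: u, w & z :: rcons s z']} -> {subset a :: t <= [:: u, w & z :: rcons s z']}.
  move=> aQ tsub x; rewrite [x \in a :: t]inE => /predU1P[->|/tsub //].
  by move: aQ; rewrite !inE => /orP[]->; rewrite ?orbT.
have sub0 : {subset z :: rcons s z' <= [:: u, w & z :: rcons s z']}.
  by move=> x xs; rewrite 2!in_cons xs !orbT.
have uQ : u \in [:: u; w] by rewrite inE eqxx.
have wQ : w \in [:: u; w] by rewrite !inE eqxx orbT.
have usN : {in s, forall x, ~~ (u -- x)} by move=> x /sN[].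
have wsN : {in s, forall x, ~~ (w -- x)} by move=> x /sN[].
(* If [u] or [w] sees both ends, it closes the arc alone. Otherwise each of them sees one end only,
   which forces [u] and [w] to be distinct, hence adjacent. *)
case: (boolP (u -- z)) adjz => [uz _ | nuz /= wz].
  case: (boolP (u -- z')) adjz' => [uz' _ | nuz' /= wz'].
    exists (u :: z :: rcons s z'); first exact: hole_of_arc.
    by apply: inQ; apply: subu.
  case: (boolP (w -- z)) => [wz | nwz].
    exists (w :: z :: rcons s z'); first exact: hole_of_arc.
    by apply: inQ; apply: subu.
  exists (w :: u :: z :: rcons s z'); last by exact: inQ (subu _ _ _ (subu _ _ _ sub0)).
  apply: two => //; case/orP: uw => // /eqP uw.
  by rewrite uw wz' in nuz'.
case: (boolP (w -- z')) adjz' => [wz' _ | nwz' /=]; last rewrite orbF => uz'.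
  exists (w :: z :: rcons s z'); first exact: hole_of_arc.
  by apply: inQ; apply: subu.
exists (u :: w :: z :: rcons s z'); last by exact: inQ (subu _ _ _ (subu _ _ _ sub0)).
apply: two => //; rewrite adj_sym; case/orP: uw => // /eqP uw.
by rewrite uw wz in nuz.
Qed.

(** Chordality of the subgraph induced by [S], expressed through holes of [G] itself;
    [chordal_induced] relates the two. *)
Definition chordal_on S := forall c, is_hole c -> ~ {subset c <= S}.

(** * Neighborhoods in the absence of even holes and sector wheels *)

Section Free.
Hypotheses (EH : even_hole_free G) (SW : sector_wheel_free G).

(** Otherwise the four vertices form a hole of even length. *)
Lemma square_chord x y z w : x -- y -> y -- z -> z -- w -> w -- x ->
  x != z -> y != w -> ~~ (x -- z) -> y -- w.
Proof.
move=> xy yz zw wx xz yw nxz; apply/negPn/negP => nyw.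
suff /EH : is_hole [:: x; y; z; w] by [].
apply/is_hole_cons; split=> //=.
- by rewrite !inE !negb_or xz (adj_neq xy) eq_sym (adj_neq wx).
- by rewrite yz zw nyw !inE !negb_or (adj_neq yz) yw (adj_neq zw).
- have zy : z == y = false by apply/negbTE; rewrite eq_sym adj_neq.
  have zw' : z == w = false by apply/negbTE; rewrite adj_neq.
  move=> t; rewrite !inE => /or3P[]/eqP->; rewrite ?eqxx ?xy ?zy ?zw' ?(negbTE nxz) //.
  by rewrite adj_sym wx orbT.
Qed.

Lemma three_nbrs c w s : uniq s -> {subset s <= c} -> 2 < size s ->
  {in s, forall x, w -- x} -> 3 <= #|nbrs w :&: [set x in c]|.
Proof.
move=> us sc s3 ws; apply: leq_trans s3 _; rewrite -(card_uniqP us).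
by apply/subset_leq_card/subsetP => x xs; rewrite !inE ws // sc.
Qed.

(** On a hole through [v], only two vertices are adjacent to [v], so another one would be outside
    N[v]. A hole that avoids [v] gives a universal wheel. *)
Lemma chordal_closed_nbrs v : chordal_on (closed_nbrs v).
Proof.
move=> c hc cN; have [c3 uc _] := hc.
case: (boolP (v \in c)) => [/rot_to[i h eh] | nv].
  have := hole_rot i hc; rewrite eh => /is_hole_cons[h3 nvh ip vE].
  have allv x : x \in h -> v -- x.
    move=> xh; have := cN x; rewrite in_closed_nbrs -(mem_rot i) eh inE xh orbT.
    by case/(_ isT)/predU1P => // xv; rewrite -xv xh in nvh.
  have uh := ipath_uniq ip.
  case: h h3 nvh {ip} uh vE allv {eh} => // a [|b [|d h]] //= _ _ uh vE allv.
  have := vE b; rewrite allv ?inE ?eqxx ?orbT // => /(_ isT)/esym/orP[]/eqP bE.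
    by move: uh; rewrite bE /= inE eqxx.
  by move: uh; rewrite bE /= mem_last andbF.
have cv x : x \in c -> v -- x.
  move=> xc; have := cN x xc; rewrite in_closed_nbrs => /predU1P[xv|//].
  by rewrite -xv xc in nv.
apply: (SW (c := c) (w := v)); split.
  by split=> //; apply: (three_nbrs uc) => //; apply: ltn_trans c3.
by left; split=> //; split=> //; apply: (three_nbrs uc) => //; apply: ltn_trans c3.
Qed.

(** A hole not inside N[u] meets N[w] - N[u]; [hole_through], closed at [u], turns it into a hole
    inside N[w], which [chordal_closed_nbrs] excludes. *)
Lemma chordal_edge_nbhd u w : eq_or_adj u w -> chordal_on (edge_nbhd u w).
Proof.
case/predU1P => [->|uw].
  by rewrite /edge_nbhd setUid; apply: chordal_closed_nbrs.
move=> c hc cN.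
case: (boolP (all (mem (closed_nbrs u)) c)) => [/allP /(chordal_closed_nbrs hc) //|].
case/allPn => e ec /= eu.
pose E := closed_nbrs w :\: closed_nbrs u.
have cuw x : x \in c -> (x \in closed_nbrs u) || (x \in E).
  by move/cN; rewrite in_setU in_setD; case: (x \in closed_nbrs u).
have eE : e \in E by have := cuw e ec; rewrite (negbTE eu).
have dE : [disjoint E & edge_nbhd u u].
  rewrite disjoint_subset; apply/subsetP => x.
  by rewrite /E !inE => /andP[/negbTE->].
have uu : eq_or_adj u u by rewrite /eq_or_adj eqxx.
have [|d hd dsub] := hole_through uu hc ec eE dE.
  by move=> x y _ /cuw; rewrite orbC /edge_nbhd setUid.
apply: (chordal_closed_nbrs (v := w) hd) => x /dsub.
rewrite !inE orbb => /predU1P[->|/andP[xc]].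
  by rewrite adj_sym uw orbT.
rewrite -!in_closed_nbrs; case/orP=> [/andP[] //|/touchesP[y]].
rewrite inE !in_closed_nbrs negb_or => /andP[/andP[yu nuy] yw] xy.
have xu : x != u by apply: contraNneq nuy => <-.
have yw' : w -- y by case/predU1P: yw => // yw; rewrite yw uw in nuy.
have := cN x xc; rewrite in_edge_nbhd (negbTE xu) /= => /orP[ux|//].
case: (x =P w) => //= /eqP xw.
(* In the square [u x y w] the diagonal [u y] is missing, so [x w] is an edge. *)
by rewrite adj_sym; apply: (square_chord ux xy); rewrite // 1?adj_sym // eq_sym.
Qed.

Lemma ipath_adjl x t : ipath (x :: t) -> {in t, forall y, (x -- y) = (y == head x t)}.
Proof.
case: t => // z t ip; have /andP[nz _] := ipath_uniq (ipath_behead ip).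
case/and4P: ip => xz _ /allP nt _ y.
rewrite inE => /predU1P[->|yt]; first by rewrite xz eqxx.
by rewrite (negbTE (nt y yt)); apply/esym/negbTE; apply: contraNneq nz => /= <-.
Qed.

Lemma ipath_adjr x t : ipath (rcons t x) -> {in t, forall y, (y -- x) = (y == last x t)}.
Proof.
move=> ip y /(nthP x)[i lt_i <-].
have /ipath_nth-/(_ x)[ut adjE] := ip.
have := adjE i (size t); rewrite size_rcons ltnS leqnn lt_i !nth_rcons lt_i ltnn eqxx => /(_ isT) ->.
have ut' : uniq t by move: ut; rewrite rcons_uniq => /andP[].
rewrite -nth_last nth_uniq //; last by case: (size t) lt_i.
by case: (size t) lt_i => // n _; rewrite eqSS eq_sym.
Qed.

Lemma hole_glue x y s t : ipath (x :: rcons s y) -> ipath (y :: rcons t x) ->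
  s != [::] -> t != [::] ->
  {in s & t, forall a b, (a != b) && ~~ (a -- b)} -> is_hole (x :: s ++ y :: t).
Proof.
move=> ips ipt s0 t0 anti.
have us := ipath_uniq ips; have ut := ipath_uniq ipt.
have ip1 := ipath_behead ips.
have ip2 : ipath (y :: t) by move: ipt; rewrite -rcons_cons -cats1 => /ipath_catl.
have [ny nxy] := andP (ipath_ends ips s0).
apply/is_hole_cons; split.
- by rewrite size_cat /=; case: (s) (t) s0 t0 => [|? ?] [|? ?] // _ _; rewrite /= !addnS !addSn.
- have := us; rewrite cons_uniq mem_rcons inE negb_or => /andP[/andP[nx nxs] _].
  have := ut; rewrite cons_uniq rcons_uniq => /and3P[_ nxt _].
  by rewrite mem_cat inE !negb_or nxs nx.
- exact: ipath_cat.
have hE : head x (s ++ y :: t) = head x (rcons s y) by case: (s) s0.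
have lE : last x (s ++ y :: t) = last x t.
  by rewrite last_cat /=; case: (t) t0.
move=> a; rewrite hE lE mem_cat inE => /or3P[as_|/eqP->|at_].
- rewrite (ipath_adjl ips) ?mem_rcons ?inE ?as_ ?orbT //.
  suff -> : a == last x t = false by rewrite orbF.
  have : last x t \in t by case: (t) t0 => // b t' _; exact: (mem_last b t').
  by move=> lt; apply/negbTE; case/andP: (anti a _ as_ lt).
- rewrite (negbTE nxy); apply/esym/norP; split.
    case: (s) s0 us => // b s' _ /= /and3P[_ + _].
    by apply: contraNneq => <-; rewrite mem_rcons inE eqxx.
  case: (t) t0 ut => // b t' _ /= /andP[+ _].
  by apply: contraNneq => ->; rewrite -rcons_cons mem_rcons inE mem_last orbT.
rewrite adj_sym (ipath_adjr (ipath_behead ipt)) //.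
suff -> : a == head x (rcons s y) = false by [].
have hs : head x (rcons s y) \in s by case: (s) s0 => // b s' _; rewrite inE eqxx.
by apply/negbTE; rewrite eq_sym; case/andP: (anti _ _ hs at_).
Qed.

(** Only edges inside [S] are used; by reflexivity every vertex, even one outside [S], is linked to
    itself. *)
Definition linked S x y :=
  connect [rel a b | [&& a \in S, b \in S & a -- b]] x y.

Lemma linkedC S x y : linked S x y = linked S y x.
Proof.
apply: sym_connect_sym => a b /=; rewrite adj_sym.
by case: (a \in S); case: (b \in S).
Qed.

Lemma linked_step S x y z : linked S x y -> y \in S -> z \in S -> y -- z -> linked S x z.
Proof. by move=> xy yS zS yz; apply: connect_trans xy (connect1 _) => /=; rewrite yS zS. Qed.

Lemma linkedP S x y : linked S x y ->
  exists s, [/\ path (@adj G) x s, last x s = y & {in s, forall z, z \in S /\ linked S x z}].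
Proof.
case/connectP => s ps ->; exists s; split=> //.
  by apply: sub_path ps => a b /and3P[].
move=> z zs; split; last by apply: (path_connect ps); rewrite inE zs orbT.
elim: s x ps zs => //= b s IH a /andP[/and3P[_ bS _] ps].
by rewrite inE => /predU1P[->|/(IH b ps)].
Qed.

(** The walk from [x] through [a] and [b] to [y] is shortened by [walk_ipath], and its interior
    keeps to vertices linked to [a]. *)
Lemma ipath_through S x y a b : x != y -> x -- a -> y -- b -> a \in S -> linked S a b ->
  exists2 s, ipath (x :: rcons s y) & {in s, forall z, z \in S /\ linked S a z}.
Proof.
move=> xy xa yb aS /linkedP[s [ps ls sS]].
have [|t [ip lt ts]] := @walk_ipath x (a :: rcons s y).
  by rewrite /= xa rcons_path ps ls adj_sym.
move: lt; rewrite /= last_rcons => lt.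
case: (lastP t) ip lt ts => [|r y'] ip; first by move=> /= xy'; rewrite xy' eqxx in xy.
rewrite last_rcons => ey; rewrite ey {y' ey} in ip * => ts.
exists r => // u ur; have := ts u.
rewrite mem_rcons !inE mem_rcons !inE ur orbT => /(_ isT)/or3P[/eqP->|/eqP uy|/sS] //.
  by split=> //; apply: connect0.
by have := ipath_uniq ip; rewrite -uy /= rcons_uniq ur !andbF.
Qed.

(** * A vertex dominated by the center lies on no hole *)

Section Dominated.
Variables v b : G.
Hypotheses (vb : v -- b) (bv : forall y, b -- y -> y \in closed_nbrs v)
  (conn : {in ~: closed_nbrs v &, forall x y, linked (~: closed_nbrs v) x y}).

(* Otherwise N(v) meets the hole in an arc around b whose ends are joined by a
   path avoiding N[v], which makes v the center of a sector wheel. *)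
Lemma hole_dominated c : is_hole c -> b \notin c.
Proof.
move=> hc; apply/negP => bc.
pose D := ~: closed_nbrs v.
(* If [v] were on the hole, it would be one of the two neighbors of [b] there; the other one, not
   adjacent to [v], would be a neighbor of [b] outside N[v]. *)
have vc : v \notin c.
  apply/negP => vc; case: (rot_to bc) => i h def.
  have := hole_rot i hc; rewrite def => /is_hole_cons[h3 _ ip bE].
  have vh : v \in h.
    have : v \in b :: h by rewrite -def mem_rot.
    by rewrite inE eq_sym (negbTE (_ : b != v)) // eq_sym adj_neq.
  case: h h3 ip bE vh {def} => // z h; case: (lastP h) => // s z' h3 ip bE vh.
  have s0 : s != [::] by case: (s) h3.
  have /andP[zz' nzz'] := ipath_ends ip s0.
  have bz : b -- z by rewrite bE ?inE ?eqxx.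
  have z'h : z' \in z :: rcons s z' by rewrite inE mem_rcons inE eqxx orbT.
  have bz' : b -- z' by rewrite bE //= last_rcons eqxx orbT.
  have := bE v vh; rewrite adj_sym vb /= last_rcons => /esym/orP[]/eqP ev.
    have := bv bz'; rewrite in_closed_nbrs ev (negbTE nzz') orbF.
    by rewrite eq_sym (negbTE zz').
  by have := bv bz; rewrite in_closed_nbrs ev adj_sym (negbTE nzz') (negbTE zz').
(* [E] collects the vertices of N[v] without neighbors outside N[v]; [b] is one of them. *)
pose E := closed_nbrs v :\: [set x | touches D x].
have EN x y : x \in E -> x -- y -> y \in closed_nbrs v.
  rewrite in_setD inE => /andP[nt _] xy; apply: contraNT nt => yD.
  by apply/touchesP; exists y => //; rewrite in_setC.
have bE : b \in E.
  rewrite in_setD inE in_closed_nbrs vb orbT andbT; apply/touchesP => -[y].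
  by rewrite in_setC => yD /bv; apply/negP.
have EsubN x : x \in E -> x \in closed_nbrs v by rewrite in_setD => /andP[].
have tN x : touches E x -> x \in closed_nbrs v.
  by case/touchesP => y yE xy; apply: (EN y) => //; rewrite adj_sym.
case: (hole_arc hc bc bE) => [small | [z [s [z' [ip s0 sub sE /and4P[zE tz zE' tz']]]]]].
  by apply: (chordal_closed_nbrs (v := v) hc) => x /small /orP[/EsubN|/tN].
have toD x : x \notin E -> touches E x -> exists2 a, a \in D & x -- a.
  move=> xE /tN xN; apply/touchesP; apply: contraNT xE => nt.
  by rewrite in_setD inE nt.
have [a aD za] := toD _ zE tz; have [a' aD' za'] := toD _ zE' tz'.
have /andP[zz' nzz'] := ipath_ends ip s0.
(* The ends of the arc have neighbors in [D]; a path through the connected set [D] closes the arc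
   into another hole. *)
have [|r ipr rD'] := @ipath_through D z' z a' a _ za' za aD' (conn aD' aD).
  by rewrite eq_sym.
have rD x : x \in r -> x \in D by case/rD'.
have r0 : r != [::].
  by apply: contraNneq nzz' => r0; move: ipr; rewrite r0 /= adj_sym => /andP[].
have hd : is_hole (z :: s ++ z' :: r).
  apply: hole_glue => // x y /sE xE /rD yD; apply/andP; split.
    by apply: contraTneq yD => <-; rewrite in_setC negbK EsubN.
  by apply: contraTN yD => /(EN _ _ xE); rewrite in_setC negbK.
have vadj x : x \in z :: rcons s z' -> v -- x.
  move=> xs; have := sub x xs.
  have : x \in closed_nbrs v.
    by move: xs; rewrite inE mem_rcons inE => /or3P[/eqP->|/eqP->|/sE/EsubN]; auto.
  by rewrite in_closed_nbrs => /predU1P[-> vc'|//]; rewrite vc' in vc.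
have in_d x : (x \in z :: s ++ z' :: r) = (x \in z :: rcons s z') || (x \in r).
  by rewrite -cat_rcons !inE mem_cat orbA.
apply: (SW (c := z :: s ++ z' :: r) (w := v)).
have wheel : is_wheel (z :: s ++ z' :: r) v.
  split=> //.
    rewrite in_d negb_or; apply/andP; split; first by apply: contra vc => /sub.
    by apply/negP => /rD; rewrite in_setC in_closed_nbrs eqxx.
  apply: (three_nbrs (s := z :: rcons s z')) => //; first exact: ipath_uniq.
    by move=> x xs; rewrite in_d xs.
  by rewrite /= size_rcons; case: (s) s0.
(* On the new hole, [v] sees exactly the arc, an induced path. *)
split=> //; right; exists (z :: rcons s z'); split; first exact: ipath_is_path.
apply/setP => x; rewrite in_setI inE [in LHS]inE [RHS]inE in_d.
case: (boolP (x \in z :: rcons s z')) => [/vadj-> //|_] /=.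
case: (boolP (x \in r)) => [/rD|]; last by rewrite andbF.
by rewrite in_setC in_closed_nbrs negb_or => /andP[_ /negbTE->].
Qed.

End Dominated.

(** * Extending partitions *)

Definition extends S u w (W1 W2 : {set G}) := exists X1 X2 : {set G},
  [/\ W1 \subset X1 /\ W2 \subset X2, chordal_on X1, chordal_on X2,
      X1 :&: X2 = [set u; w] & X1 :|: X2 = S].

(** Weak flat path extendability of the subgraph induced by [S], in a form where any partition of
    N[Q] may be prescribed; it is derived in [weakly_FPE_extendable]. *)
Definition extendable S := forall u w (W1 W2 : {set G}),
  u \in S -> w \in S -> eq_or_adj u w ->
  W1 :&: W2 = [set u; w] -> W1 :|: W2 = edge_nbhd u w :&: S ->
  extends S u w W1 W2.

Lemma edge_sub_nbhd u w x : x \in [set u; w] -> x \in edge_nbhd u w.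
Proof. by rewrite in_edge_nbhd !inE => /orP[]->; rewrite ?orbT. Qed.

Lemma in_setI_eq (A B C : {set G}) x : A :&: B = C -> (x \in A) && (x \in B) = (x \in C).
Proof. by move=> <-; rewrite inE. Qed.

Lemma in_setU_eq (A B C : {set G}) x : A :|: B = C -> (x \in A) || (x \in B) = (x \in C).
Proof. by move=> <-; rewrite inE. Qed.

Section Minimal.
Hypothesis minG : forall S, S \proper [set: G] -> extendable S.
Variables (p q : G) (W1 W2 : {set G}).
Hypotheses (pq : eq_or_adj p q) (WI : W1 :&: W2 = [set p; q])
  (WU : W1 :|: W2 = edge_nbhd p q).

Lemma proper_extends S u w (U1 U2 : {set G}) z : z \notin S ->
  u \in S -> w \in S -> eq_or_adj u w ->
  U1 :&: U2 = [set u; w] -> U1 :|: U2 = edge_nbhd u w :&: S ->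
  extends S u w U1 U2.
Proof. by move=> zS; apply: minG; rewrite properT; apply: contraNneq zS => ->; rewrite inE. Qed.

Lemma restrict_extends B b : b \in B -> p \notin B -> q \notin B ->
  extends (~: B) p q (W1 :\: B) (W2 :\: B).
Proof.
move=> bB pB qB; apply: (proper_extends (z := b)); rewrite ?inE ?bB //.
  rewrite -setDIl WI; apply/setP => x; rewrite !inE.
  by case: eqP => [->|_]; rewrite ?pB //=; case: eqP => [->|_]; rewrite ?qB ?andbF.
by rewrite -setDUl WU setDE.
Qed.

(* The part outside B is extended from p and q, and the resulting partition of
   the attachment of B is then extended into B from u and w. *)
Lemma separation_extends u w B b z : eq_or_adj u w -> b \in B ->
    [disjoint B & edge_nbhd u w] ->
    (forall x y, x \in B -> x -- y -> (y \in B) || (y \in edge_nbhd u w)) ->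
    p \notin B -> q \notin B ->
    (forall x, x \in [set p; q] -> touches B x -> x \in [set u; w]) ->
    z \notin B -> ~~ touches B z -> z \notin [set u; w] ->
  extends [set: G] p q W1 W2.
Proof.
move=> uw bB dB clB pB qB PV zB zt zQ.
have [X1 [X2 [[WX1 WX2] cX1 cX2 XI XU]]] := restrict_extends bB pB qB.
pose Q := [set u; w].
have QB x : x \in Q -> x \notin B.
  by move/edge_sub_nbhd => xN; apply: contraL xN => xB; rewrite (disjointFr dB xB).
(* [C] consists of [Q] and the attachment of [B]; all of it lies in N[Q]. *)
pose C := [set x | (x \notin B) && (touches B x || (x \in Q))].
have QC x : x \in Q -> x \in C by move=> xQ; rewrite inE QB // xQ orbT.
have CN x : x \in C -> x \in edge_nbhd u w.
  rewrite inE => /andP[xB /orP[/touchesP[y yB]|/edge_sub_nbhd //]].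
  by rewrite adj_sym => /(clB _ _ yB); rewrite (negbTE xB).
have PC x : x \in [set p; q] -> x \in C -> x \in Q.
  by move=> xP; rewrite inE => /andP[_ /orP[/PV|//]]; apply.
(* The partition already obtained on [C] is prescribed, with [Q] added to both sides; [z] lies
   outside [B :|: C], so that set is proper. *)
have [|||||X1' [X2' [[WX1' WX2'] cX1' cX2' XI' XU']]] :=
    @proper_extends (B :|: C) u w ((X1 :&: C) :|: Q) ((X2 :&: C) :|: Q) z _ _ _ uw.
- by rewrite in_setU inE (negbTE zB) (negbTE zt) (negbTE zQ).
- by rewrite in_setU QC ?orbT // !inE eqxx.
- by rewrite in_setU QC ?orbT // !inE eqxx orbT.
- rewrite -setUIl setIACA setIid XI; apply/setP => x.
  rewrite in_setU in_setI.
  by case: (boolP (x \in Q)) => //= xQ; rewrite ?orbT // orbF; apply: contraNF xQ => /andP[]; apply: PC.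
- rewrite setUACA setUid -setIUl XU; apply/setP => x.
  rewrite in_setU !in_setI in_setC [RHS]andbC in_setU.
  case: (boolP (x \in B)) => /= [xB|xB].
    by rewrite (disjointFr dB xB); apply/negbTE; apply: contraL xB => /QB.
  case: (boolP (x \in C)) => /= [/CN-> //|xC].
  by apply: contraNF xC => /QC.
(* A hole of the glued set that meets [B] is rerouted through [Q] into a hole of [X']; one that
   avoids [B] lies in [X]. *)
have glue (X X' : {set G}) : (X1 :|: X2 = ~: B -> X \subset ~: B) -> chordal_on X -> chordal_on X' ->
    (X :&: C) :|: Q \subset X' -> chordal_on (X :|: X' :&: B).
  move=> /(_ XU)/subsetP XB cX cX' /subsetP subX' c hc sub.
  case: (boolP (has (mem B) c)) => [/hasP[e ec eB] | /hasPn ncB].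
    have [|d hd dsub] := hole_through uw hc ec eB dB; first by move=> x y xB _; apply: clB.
    apply: (cX' d hd) => x /dsub /orP[xQ|/andP[xc]].
      by apply: subX'; rewrite inE xQ orbT.
    have := sub x xc; rewrite !inE => /orP[xX|/andP[-> //]].
    have xB : x \notin B by have := XB x xX; rewrite inE.
    rewrite (negbTE xB) /= => tx; apply: subX'.
    by rewrite in_setU in_setI xX inE xB tx.
  apply: (cX c hc) => x xc; have := sub x xc.
  by rewrite !inE (negbTE (ncB x xc : x \notin B)) andbF orbF.
(* No vertex of [B] is in N[P]: a neighbor of it in P would belong to [Q], but [B] is disjoint from
   N[Q]. *)
have WB x : x \in B -> x \notin edge_nbhd p q.
  move=> xB; apply/negP; rewrite in_edge_nbhd.
  have np y : y \in [set p; q] -> x == y = false.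
    move=> yP; apply: contraTF xB => /eqP ->.
    by move: yP; rewrite !inE => /orP[]/eqP->.
  rewrite (np p) ?(np q) ?inE ?eqxx ?orbT //=.
  have toQ y : y \in [set p; q] -> y -- x -> False.
    move=> yP yx; have yQ : y \in Q by apply: PV => //; apply/touchesP; exists x.
    have := disjointFr dB xB; rewrite in_edge_nbhd.
    by move: yQ; rewrite !inE => /orP[]/eqP <-; rewrite yx ?orbT.
  by case/orP; apply: toQ; rewrite !inE eqxx ?orbT.
have subW (W X X' : {set G}) : W \subset W1 :|: W2 -> W :\: B \subset X -> W \subset X :|: X' :&: B.
  rewrite WU => /subsetP WN /subsetP WX; apply/subsetP => x xW.
  rewrite inE WX // inE xW andbT.
  by apply: contraL (WN x xW) => /WB.
exists (X1 :|: X1' :&: B), (X2 :|: X2' :&: B); split.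
- by split; apply: subW; rewrite ?subsetUl ?subsetUr.
- by apply: glue => // <-; rewrite subsetUl.
- by apply: glue => // <-; rewrite subsetUr.
- apply/setP => x; rewrite -XI !(in_setI, in_setU).
  have := in_setU_eq x XU; have := in_setI_eq x XI'; rewrite in_setC.
  case: (boolP (x \in B)) => [xB|xB]; last by rewrite !andbF !orbF.
  have -> : x \in [set u; w] = false by apply: contraTF xB => /QB.
  by do 4!case: (x \in _).
- apply/setP => x; rewrite !in_setU !in_setI in_setT.
  have := in_setU_eq x XU; have := in_setU_eq x XU'; rewrite in_setU in_setC.
  by case: (x \in B); case: (x \in X1); case: (x \in X2); case: (x \in X1'); case: (x \in X2').
Qed.

(** After an extension to G - B, the vertices of [B] return to their sides in [W1] and [W2]. A hole
    then has a vertex outside N[P], which is chordal; its arc outside N[P], closed up through P,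
    gives a hole avoiding [B], as no vertex of [B] has a neighbor outside N[P]. *)
Lemma dominated_extends B b : b \in B -> B \subset edge_nbhd p q ->
    (forall x y, x \in B -> x -- y -> y \in edge_nbhd p q) ->
    p \notin B -> q \notin B ->
  extends [set: G] p q W1 W2.
Proof.
move=> bB /subsetP BN clB pB qB.
have [X1 [X2 [[WX1 WX2] cX1 cX2 XI XU]]] := restrict_extends bB pB qB.
have glue (X W : {set G}) : W :\: B \subset X -> [set p; q] \subset X -> W \subset edge_nbhd p q ->
    chordal_on X -> chordal_on (X :|: W).
  move=> /subsetP WX /subsetP PX /subsetP WN cX c hc sub.
  case: (boolP (all (mem (edge_nbhd p q)) c)) => [/allP /(chordal_edge_nbhd pq hc) // |].
  case/allPn => e ec /= eN.
  have eE : e \in ~: edge_nbhd p q by rewrite inE.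
  have dE : [disjoint ~: edge_nbhd p q & edge_nbhd p q].
    by rewrite disjoint_subset; apply/subsetP => x; rewrite inE.
  have [|d hd dsub] := hole_through pq hc ec eE dE.
    by move=> x y _ _ _; rewrite in_setC orNb.
  apply: (cX d hd) => x /dsub /orP[/PX //|/andP[xc]].
  have := sub x xc; rewrite in_setU => /orP[//|xW].
  rewrite in_setC (WN x xW) => /touchesP[y]; rewrite in_setC => yN xy.
  by apply: WX; rewrite inE xW andbT; apply: contra yN => /clB; apply.
have WN : W1 \subset edge_nbhd p q /\ W2 \subset edge_nbhd p q.
  by rewrite -WU subsetUl subsetUr.
have PX : [set p; q] \subset X1 /\ [set p; q] \subset X2.
  by rewrite -XI subsetIl subsetIr.
case: WN PX => WN1 WN2 [PX1 PX2].
exists (X1 :|: W1), (X2 :|: W2); split; try exact: glue.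
- by rewrite !subsetUr.
- apply/setP => x; rewrite -XI !(in_setI, in_setU).
  have := in_setI_eq x WI; rewrite -(in_setI_eq x XI).
  have /implyP := subsetP WX1 x; have /implyP := subsetP WX2 x.
  have := in_setU_eq x XU; rewrite in_setC !in_setD.
  by case: (x \in B); case: (x \in X1); case: (x \in X2); case: (x \in W1); case: (x \in W2).
- apply/setP => x; rewrite !in_setU in_setT.
  have := in_setU_eq x XU; have := in_setU_eq x WU; have /implyP := BN x; rewrite in_setC.
  by case: (x \in B); case: (x \in X1); case: (x \in X2); case: (x \in W1); case: (x \in W2);
     case: (x \in _).
Qed.

(** By [hole_dominated], [b] lies on no hole and can be added to any chordal set. If [b] is in P,
    the extension to G - b starts from [v] in its place. *)
Lemma dominated_vertex_extends v b : v -- b ->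
    (forall y, b -- y -> y \in closed_nbrs v) ->
    {in ~: closed_nbrs v &, forall x y, linked (~: closed_nbrs v) x y} ->
  extends [set: G] p q W1 W2.
Proof.
move=> vb bv conn.
have nob c : is_hole c -> b \notin c by apply: hole_dominated conn c.
have chadd (X Y : {set G}) : chordal_on X -> (forall x, x \in Y -> x != b -> x \in X) -> chordal_on Y.
  move=> cX YX c hc cY; apply: (cX c hc) => x xc; apply: (YX _ (cY x xc)).
  by apply: contraNneq (nob c hc) => <-.
case: (boolP (b \in [set p; q])) => bP; last first.
  have [pb qb] : p != b /\ q != b.
    by move: bP; rewrite !inE negb_or ![b == _]eq_sym => /andP[].
  have [X1 [X2 [[WX1 WX2] cX1 cX2 XI XU]]] :
      extends (~: [set b]) p q (W1 :\: [set b]) (W2 :\: [set b]).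
    by apply: (restrict_extends (b := b)); rewrite ?inE.
  (* [b] joins the first side unless it belongs to [W2]. *)
  pose Y1 := [set x | (x \in X1) || (x == b) && (b \notin W2)].
  pose Y2 := [set x | (x \in X2) || (x == b) && (b \in W2)].
  have bI : ~~ ((b \in W1) && (b \in W2)) by rewrite (in_setI_eq b WI).
  have bX : ~~ ((b \in X1) || (b \in X2)) by rewrite (in_setU_eq b XU) !inE eqxx.
  exists Y1, Y2; split.
  - split; apply/subsetP => x xW; rewrite inE.
      case: (x =P b) xW => [->|/eqP xb] xW; last by rewrite (subsetP WX1) // !inE xb.
      by rewrite (_ : b \notin W2) ?orbT //; apply: contra bI => ->; rewrite xW.
    case: (x =P b) xW => [->|/eqP xb] xW; first by rewrite xW orbT.
    by rewrite (subsetP WX2) // !inE xb.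
  - by apply: (chadd X1) => // x; rewrite inE => /orP[//|/andP[->]].
  - by apply: (chadd X2) => // x; rewrite inE => /orP[//|/andP[->]].
  - apply/setP => x; rewrite -XI !inE; case: (x =P b) => [->|_] /=.
      by move: bX; case: (b \in X1); case: (b \in X2); case: (b \in W2).
    by rewrite !orbF.
  - apply/setP => x; have := in_setU_eq x XU; rewrite !inE; case: (x =P b) => [->|_] /=.
      by rewrite !orbA; case: (b \in W2); rewrite ?orbT.
    by rewrite !orbF.
pose r := if b == p then q else p.
have Pr : [set p; q] = [set b; r].
  rewrite /r; case: (b =P p) bP => [-> //|/eqP bp]; rewrite !inE (negbTE bp) /= => /eqP->.
  by rewrite setUC.
have Nr : edge_nbhd p q = edge_nbhd b r.
  rewrite /r; case: (b =P p) bP => [-> //|/eqP bp]; rewrite !inE (negbTE bp) /= => /eqP->.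
  by rewrite edge_nbhdC.
have br : eq_or_adj b r.
  rewrite /r; case: (b =P p) bP => [-> //|/eqP bp]; rewrite !inE (negbTE bp) /= => /eqP->.
  by rewrite eq_or_adjC.
have vb' : v != b := adj_neq vb.
(* In G - b, the pair [v], [w] replaces P: [w] is the other vertex of P, or [v] itself when P is the
   single vertex [b]. *)
pose w := if r == b then v else r.
have wr : r != b -> w = r by rewrite /w => /negbTE->.
have wb : w != b by rewrite /w; case: (r =P b) => [//|/eqP].
have vw : eq_or_adj v w.
  rewrite /w; case: (r =P b) => [_|/eqP rb]; first by rewrite /eq_or_adj eqxx.
  case/predU1P: br => [br|/bv]; first by rewrite br eqxx in rb.
  by rewrite in_closed_nbrs /eq_or_adj eq_sym.
pose Q := [set v; w].
have vQ : v \in Q by rewrite !inE eqxx.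
have PQ x : x \in [set p; q] -> x != b -> x \in Q.
  rewrite Pr !inE => /orP[->//|/eqP-> rb]; by rewrite wr // eqxx orbT.
have QP x : x \in Q -> x != v -> x \in [set p; q].
  rewrite Pr !inE => /orP[->//|/eqP->]; rewrite /w.
  by case: (r =P b) => _; rewrite eqxx // orbT.
have QN x : x \in Q -> x \in edge_nbhd v w := @edge_sub_nbhd v w x.
have NW x : x \in edge_nbhd p q -> x != b -> x \in edge_nbhd v w.
  have bxN : b -- x -> x \in edge_nbhd v w by move/bv => xN; rewrite in_setU xN.
  rewrite Nr in_edge_nbhd => /or4P[/eqP->|/bxN//|/eqP-> rb|rx xb]; rewrite ?eqxx //.
    by rewrite in_edge_nbhd wr // eqxx !orbT.
  case: (r =P b) rx => [->|/eqP rb] rx; first exact: bxN.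
  by rewrite in_edge_nbhd wr // rx !orbT.
have vN : v \in edge_nbhd p q by rewrite Nr in_edge_nbhd adj_sym vb orbT.
have bNQ : b \notin Q by rewrite !inE negb_or ![b == _]eq_sym vb'.
have W1N x : x \in W1 -> x \in edge_nbhd p q by rewrite -WU inE => ->.
have W2N x : x \in W2 -> x \in edge_nbhd p q by rewrite -WU inE orbC => ->.
(* Both sides receive [Q], the second one the rest of [W2] without [b], and the first one all that
   remains of N[Q] - b. *)
pose U2 := (W2 :\ b) :|: Q.
pose U1 := Q :|: ((edge_nbhd v w :\ b) :\: U2).
have splitI (A W R : {set G}) : (R :|: A :\: (W :|: R)) :&: (W :|: R) = R.
  by apply/setP => x; rewrite !inE; case: (x \in R); case: (x \in W); rewrite ?andbF.
have splitU (A W R : {set G}) : (R :|: A :\: (W :|: R)) :|: (W :|: R) = R :|: (A :|: W).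
  apply/setP => x; rewrite !inE.
  by case: (x \in R); case: (x \in W); case: (x \in A); rewrite ?andbF.
have [|||||X1 [X2 [[WX1 WX2] cX1 cX2 XI XU]]] :=
  @proper_extends (~: [set b]) v w U1 U2 b _ _ _ vw.
- by rewrite !inE eqxx.
- by rewrite !inE.
- by rewrite !inE.
- exact: splitI.
- rewrite splitU; apply/setP => x; rewrite in_setI (in_setU x Q) (in_setU x (_ :\ _)) !in_setD1 in_setC in_set1.
  case: (boolP (x \in Q)) => [xQ|_] /=.
    by rewrite QN //=; apply/esym; apply: contraNneq bNQ => <-.
  case: (x =P b) => [_|/eqP xb] /=; rewrite ?andbF // andbT.
  case: (boolP (x \in W2)) => /= [xW|_]; last by rewrite orbF.
  by rewrite NW // W2N.
have QX x : x \in Q -> (x \in X1) && (x \in X2) by rewrite (in_setI_eq x XI).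
(* [b] joins both sides, while [v] stays in [X] only if [W] contains it. *)
pose Y (X W : {set G}) := [set x | (x == b) || (x \in X) && ((x != v) || (v \in W))].
have inY X W x : (x \in Y X W) = (x == b) || (x \in X) && ((x != v) || (v \in W)).
  by rewrite inE.
have chY (X W : {set G}) : chordal_on X -> chordal_on (Y X W).
  by move=> cX; apply: (chadd X) => // x; rewrite inE => /orP[->//|/andP[->]].
have subY (X W : {set G}) : (forall x, x \in W -> x != b -> x \in X) -> W \subset Y X W.
  move=> WX; apply/subsetP => x xW; rewrite inE.
  case: (x =P b) => //= /eqP xb; rewrite WX //=.
  by case: (x =P v) => //= <-.
exists (Y X1 W1), (Y X2 W2); split; try exact: chY.
- split; apply: subY => x xW xb.
    apply: (subsetP WX1); rewrite (in_setU x Q) (in_setD _ U2 x) (in_setD1 x _ b) xb.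
    rewrite NW ?W1N // andbT (in_setU x _ Q) (in_setD1 x _ b) xb.
    case: (boolP (x \in Q)) => //= xQ; rewrite orbF andbT; apply: contra xQ => xW2.
    by apply: PQ => //; rewrite -(in_setI_eq x WI) xW.
  by apply: (subsetP WX2); rewrite (in_setU x _ Q) (in_setD1 x _ b) xb xW.
- apply/setP => x; rewrite in_setI !inY.
  case: (x =P b) => [->|/eqP xb] /=; first by rewrite bP.
  case: (x =P v) => [->|/eqP xv] /=.
    by case/andP: (QX v vQ) => -> -> /=; rewrite (in_setI_eq v WI).
  rewrite !andbT (in_setI_eq x XI); apply/idP/idP => xQ; [exact: QP | exact: PQ].
- apply/setP => x; rewrite in_setU !inY in_setT.
  case: (x =P b) => [->|/eqP xb] //=.
  case: (x =P v) => [->|/eqP xv] /=.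
    by case/andP: (QX v vQ) => -> -> /=; rewrite (in_setU_eq v WU).
  by rewrite !andbT (in_setU_eq x XU) !inE.
Qed.

End Minimal.

(** * Full star cutsets *)

Section StarCutset.
Hypothesis minG : forall S, S \proper [set: G] -> extendable S.

Definition component S a := [set x | linked S a x].

Lemma component_in S a x : a \in S -> x \in component S a -> x \in S.
Proof.
move=> aS; rewrite inE => /linkedP[s [_ <- sS]].
by have := mem_last a s; rewrite inE => /predU1P[->|/sS[]].
Qed.

Lemma component_sub S a B : a \in B ->
  (forall x y, x \in B -> y \in S -> x -- y -> y \in B) -> {subset component S a <= B}.
Proof.
move=> aB clB x; rewrite inE => /linkedP[s [ps <- sS]].
have {sS} : {subset s <= S} by move=> z /sS[].
elim: s a aB ps => //= b s IH a aB /andP[ab ps] sS.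
apply: IH => //; last by move=> z zs; apply: sS; rewrite inE zs orbT.
by apply: (clB a) => //; apply: sS; rewrite inE eqxx.
Qed.

Lemma touches_sub B B' x : {subset B <= B'} -> touches B x -> touches B' x.
Proof. by move=> sub /touchesP[y /sub yB xy]; apply/touchesP; exists y. Qed.

Lemma extends_sym S p q W1 W2 : extends S p q W1 W2 -> extends S q p W1 W2.
Proof. by rewrite /extends setUC. Qed.

Definition bipartitioned p q (W1 W2 : {set G}) :=
  [/\ eq_or_adj p q, W1 :&: W2 = [set p; q] & W1 :|: W2 = edge_nbhd p q].

Lemma bipartitioned_sym p q W1 W2 : bipartitioned p q W1 W2 -> bipartitioned q p W1 W2.
Proof. by case=> pq WI WU; split; [rewrite eq_or_adjC | rewrite setUC | rewrite edge_nbhdC]. Qed.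

(** The case of [separation_extends] where [B] is the component of [a] in G - N[{u, w}]; being a
    component, [B] has its whole boundary in N[{u, w}]. *)
Lemma component_extends p q W1 W2 u w a z : bipartitioned p q W1 W2 ->
    eq_or_adj u w -> a \notin edge_nbhd u w ->
    (forall x, x \in [set p; q] -> x \notin component (~: edge_nbhd u w) a) ->
    (forall x, x \in [set p; q] ->
       touches (component (~: edge_nbhd u w) a) x -> x \in [set u; w]) ->
    z \notin component (~: edge_nbhd u w) a ->
    ~~ touches (component (~: edge_nbhd u w) a) z -> z \notin [set u; w] ->
  extends [set: G] p q W1 W2.
Proof.
set S := ~: edge_nbhd u w; set B := component S a.
move=> [pq WI WU] uw aN PB PV zB zt zQ.
have aS : a \in S by rewrite in_setC.
have BS x : x \in B -> x \in S by apply: component_in.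
have clB x y : x \in B -> y \in S -> x -- y -> y \in B.
  by move=> xB yS xy; move: (xB); rewrite !inE => ax; apply: linked_step ax (BS x xB) yS xy.
apply: (separation_extends minG pq WI WU uw (b := a) (B := B) (z := z)) => //.
- by rewrite inE; apply: connect0.
- by rewrite disjoint_subset; apply/subsetP => x /BS; rewrite in_setC.
- move=> x y xB xy; case: (boolP (y \in edge_nbhd u w)) => yN; rewrite ?orbT // orbF.
  by apply: (clB x) => //; rewrite in_setC.
- by apply: PB; rewrite !inE eqxx.
- by apply: PB; rewrite !inE eqxx orbT.
Qed.

(** * Two anticomplete parts outside the neighborhood of the center *)

Definition separated v B1 B2 :=
  [/\ B1 :|: B2 = ~: closed_nbrs v, [disjoint B1 & B2]
    & {in B1 & B2, forall x y, ~~ (x -- y)}].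

Lemma separated_sym v B1 B2 : separated v B1 B2 -> separated v B2 B1.
Proof.
case=> cov dis anti; split; [by rewrite setUC | by rewrite disjoint_sym |].
by move=> x y xB yB; rewrite adj_sym; apply: anti.
Qed.

Section Separated.
Variables (v : G) (B1 B2 : {set G}).
Hypothesis sep : separated v B1 B2.

Lemma sepN x : x \in B1 -> x \notin closed_nbrs v.
Proof. by case: sep => cov _ _ xB; rewrite -in_setC -cov inE xB. Qed.

Lemma sep_adj x y : x \in B1 -> x -- y -> (y \in B1) || (y \in closed_nbrs v).
Proof.
case: sep => cov _ anti xB xy; case: (boolP (y \in closed_nbrs v)) => yN; rewrite ?orbT // orbF.
have : y \in B1 :|: B2 by rewrite cov inE.
by rewrite inE => /orP[//|yB]; have := anti x y xB yB; rewrite xy.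
Qed.

Lemma sep_notin x : x \in B2 -> x \notin B1 /\ ~~ touches B1 x.
Proof.
case: sep => _ dis anti xB; split; first by rewrite (disjointFl dis xB).
by apply/touchesP => -[y yB]; rewrite adj_sym; apply/negP/anti.
Qed.

(** In the square [x y v p] the diagonal [x v] is missing, since [x] is outside N[v]. *)
Lemma sep_square x y p : x \in B1 -> x -- y -> v -- y -> v -- p -> p -- x -> y != p -> y -- p.
Proof.
move=> /sepN; rewrite in_closed_nbrs negb_or => /andP[xv nvx] xy vy vp px yp.
by apply: (square_chord xy _ vp px); rewrite // adj_sym.
Qed.

Lemma sep_component a p : a \in B1 ->
  {subset component (~: edge_nbhd v p) a <= B1}.
Proof.
move=> aB; apply: component_sub => // x y xB yS /(sep_adj xB) /orP[//|yN].
by move: yS; rewrite in_setC in_setU yN.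
Qed.

End Separated.

Section Extensions.
Variables (v : G) (B1 B2 : {set G}) (b1 b2 : G).
Hypotheses (sep : separated v B1 B2) (b1B : b1 \in B1) (b2B : b2 \in B2).
Let sep' := separated_sym sep.

(** [B1] is cut off by [v]; the vertex [b2] of the other part is the witness that something remains
    beyond [B1] and its attachment. *)
Lemma center_extends p q W1 W2 : bipartitioned p q W1 W2 ->
    p \notin B1 -> q \notin B1 ->
    (forall x, x \in [set p; q] -> touches B1 x -> x = v) ->
  extends [set: G] p q W1 W2.
Proof.
move=> [pq WI WU] pB qB PV; have [b2B1 b2t] := sep_notin sep b2B.
have vv : eq_or_adj v v by rewrite /eq_or_adj eqxx.
apply: (separation_extends minG pq WI WU vv (b := b1) (B := B1) (z := b2)) => //.
- by rewrite disjoint_subset; apply/subsetP => x /(sepN sep); rewrite /edge_nbhd setUid.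
- by move=> x y xB xy; rewrite /edge_nbhd setUid; apply: (sep_adj sep xB).
- by move=> x xP /(PV x xP)->; rewrite !inE eqxx.
- have := sepN sep' b2B; apply: contra; rewrite !inE orbb => ->//.
Qed.

(** [dominated_extends] applies to [B1]. If [x] in [B1] has a neighbor [y] in N(v), then [x] also
    has a neighbor [r] in P; either [r = v], or [sep_square] puts [y] in N[r]. *)
Lemma covered_extends p q W1 W2 : bipartitioned p q W1 W2 ->
    {subset B1 <= edge_nbhd p q} -> p \notin B1 -> q \notin B1 ->
    (forall x, x \in [set p; q] -> touches B1 x -> x \in closed_nbrs v) ->
    v \in edge_nbhd p q ->
  extends [set: G] p q W1 W2.
Proof.
move=> [pq WI WU] BN pB qB PV vN.
apply: (dominated_extends minG pq WI WU b1B) => //; first exact/subsetP.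
move=> x y xB xy; case/orP: (sep_adj sep xB xy) => [/BN //|].
rewrite in_closed_nbrs => /predU1P[->//|vy].
have near r : r \in [set p; q] -> r -- x -> y \in closed_nbrs r.
  move=> rP rx; have : r \in closed_nbrs v.
    by apply: PV => //; apply/touchesP; exists x.
  rewrite !in_closed_nbrs => /predU1P[->|vr]; first by rewrite vy orbT.
  case: (y =P r) => //= /eqP yr; rewrite adj_sym.
  exact: (sep_square sep xB xy).
have xP r : r \in [set p; q] -> x != r.
  move=> rP; apply: contraNneq (_ : r \notin B1) => [<- //|].
  by move: rP; rewrite !inE => /orP[]/eqP->.
have pP : p \in [set p; q] by rewrite !inE eqxx.
have qP : q \in [set p; q] by rewrite !inE eqxx orbT.
have := BN x xB; rewrite in_edge_nbhd (negbTE (xP p pP)) (negbTE (xP q qP)) /=.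
by rewrite in_setU => /orP[/(near p pP)->|/(near q qP)->]; rewrite ?orbT.
Qed.

End Extensions.

(** * Extension from P according to its position relative to the center *)

Lemma sep_outside v B1 B2 x : separated v B1 B2 -> x \notin closed_nbrs v ->
  (x \in B1) || (x \in B2).
Proof. by case=> cov _ _ xN; rewrite -in_setU cov in_setC. Qed.

(** If [q] is outside N[v], the part without [q] is cut off by [v]. Otherwise, unless N[P] covers
    one of the parts, a component of G - N[P] inside [B1] is cut off by P itself. *)
Lemma center_in_extends v B1 B2 b1 b2 q W1 W2 : separated v B1 B2 -> b1 \in B1 -> b2 \in B2 ->
  bipartitioned v q W1 W2 -> extends [set: G] v q W1 W2.
Proof.
move=> sep b1B b2B bip; have sep' := separated_sym sep.
have vB B B' : separated v B B' -> v \notin B.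
  by move=> s; apply/negP => /(sepN s); rewrite in_closed_nbrs eqxx.
case: (boolP (q \in closed_nbrs v)) => qN; last first.
  wlog qB : B1 B2 b1 b2 sep sep' b1B b2B / q \in B1 => [hw|].
    by case/orP: (sep_outside sep qN) => qB; [apply: (hw B1 B2 b1 b2) | apply: (hw B2 B1 b2 b1)].
  have [qB2 qt] := sep_notin sep' qB.
  apply: (center_extends sep' b2B b1B bip) => //; first exact: vB sep'.
  by move=> x; rewrite !inE => /orP[/eqP-> //|/eqP-> qt']; rewrite qt' in qt.
have qB B B' : separated v B B' -> q \notin B.
  by move=> s; apply: contraL qN => /(sepN s).
have vqN x : x \in [set v; q] -> x \in closed_nbrs v.
  by rewrite !inE => /orP[]/eqP->; rewrite ?eqxx // -in_closed_nbrs.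
have vN : v \in edge_nbhd v q by rewrite in_edge_nbhd eqxx.
have vq : eq_or_adj v q by move: qN; rewrite in_closed_nbrs eq_sym.
case: (boolP (B1 \subset edge_nbhd v q)) => [/subsetP B1N|/subsetPn[a aB aN]].
  by apply: (covered_extends sep b1B bip) => //; eauto.
case: (boolP (B2 \subset edge_nbhd v q)) => [/subsetP B2N|/subsetPn[z zB zN]].
  by apply: (covered_extends sep' b2B bip) => //; eauto.
have compB := sep_component sep (p := q) aB.
apply: (component_extends bip vq aN (z := z)) => //.
- move=> x xP; apply/negP => /compB /(sepN sep); apply/negP; rewrite negbK.
  exact: vqN.
- by apply: contra (sep_notin sep zB).1 => /compB.
- by apply: contra (sep_notin sep zB).2; apply: touches_sub.
- by apply: contra zN => /edge_sub_nbhd.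
Qed.

(** The subpath runs from the last vertex satisfying [a] to the first vertex from there on
    satisfying [b]. *)
Lemma ipath_sub (a b : pred G) z t : ipath (z :: t) -> a z -> b (last z t) ->
  exists y s, [/\ ipath (y :: s), {subset y :: s <= z :: t}, a y /\ ~~ has a s,
    b (last y s) & ~~ has b (belast y s)].
Proof.
move=> ip az bl.
have : has a (z :: t) by rewrite /= az.
case/has_splitr => l [y [r [e ay nr]]].
have : has b (y :: r).
  apply/hasP; exists (last y r); first exact: mem_last.
  by have := congr1 (last z) e; rewrite last_cat /= => <-.
case/has_splitl => l' [x [r' [e' bx nl']]].
have eyr : rcons l' x ++ r' = y :: r by rewrite cat_rcons.
case: (l') nl' e' eyr => [|y' s] nl' e' eyr.
  case: eyr => ex _; subst x; exists y, [::]; split=> //.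
  by move=> u; rewrite inE => /eqP->; rewrite e mem_cat inE eqxx orbT.
case: e' => ey er; subst y'; exists y, (rcons s x).
split.
- by apply: (@ipath_catl _ r'); rewrite -[y :: _]/(rcons (y :: s) x) eyr; apply: (@ipath_catr l); rewrite -e.
- move=> u us; rewrite e mem_cat -eyr mem_cat.
  by rewrite -[y :: _]/(rcons (y :: s) x) in us; rewrite us orbT.
- split=> //; apply: contra nr; rewrite er => /hasP[u us au].
  by apply/hasP; exists u => //; rewrite -cat_rcons mem_cat us.
- by rewrite last_rcons.
- by rewrite belast_rcons.
Qed.

(** Unless N[P] covers [B2], a component of G - N[{v, p}] inside [B2] is cut off, while [q] remains
    on the other side. *)
Lemma center_adj_far_extends v B1 B2 b1 b2 p q W1 W2 :
  separated v B1 B2 -> b1 \in B1 -> b2 \in B2 -> bipartitioned p q W1 W2 ->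
  v -- p -> q \in B1 -> extends [set: G] p q W1 W2.
Proof.
move=> sep b1B b2B bip vp qB; have sep' := separated_sym sep.
have pN : p \in closed_nbrs v by rewrite in_closed_nbrs vp orbT.
have pB : p \notin B2 by apply: contraL pN => /(sepN sep').
have [qB2 qt] := sep_notin sep' qB.
have vN : v \in edge_nbhd p q by rewrite in_edge_nbhd adj_sym vp orbT.
have inP (A : Prop) x : x \in [set p; q] -> (x = p -> A) -> (x = q -> A) -> A.
  by rewrite !inE => /orP[]/eqP->; auto.
case: (boolP (B2 \subset edge_nbhd p q)) => [/subsetP B2N|/subsetPn[a aB aN]].
  apply: (covered_extends sep' b2B bip) => // x xP.
  by apply: (inP _ x xP) => -> //; rewrite (negbTE qt).
have compB := sep_component sep' (p := p) aB.
have vpN : eq_or_adj v p by rewrite /eq_or_adj vp orbT.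
have aN' : a \notin edge_nbhd v p.
  by rewrite in_setU (negbTE (sepN sep' aB)) /=; apply: contra aN => aN; rewrite in_setU aN.
have qN : q \notin closed_nbrs v by apply: (sepN sep).
apply: (component_extends bip vpN aN' (z := q)).
- move=> x xP; apply/negP => /compB xB.
  by apply: (inP _ x xP) => ex; rewrite -ex xB in pB qB2.
- move=> x xP /(touches_sub compB) tx.
  apply: (inP _ x xP) => ex; first by rewrite ex !inE eqxx orbT.
  by rewrite -ex tx in qt.
- by apply: contra qB2 => /compB.
- by apply: contra qt; apply: touches_sub.
- have qp : q != p by apply: contraTneq pN => <-.
  by rewrite !inE negb_or qp andbT; apply: contraNneq qN => ->; rewrite in_closed_nbrs eqxx.
Qed.

(** Unless N[p] covers one of the parts, the edge [v p] cuts off a component inside [B1], and a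
    vertex of [B2] outside N[p] remains. *)
Lemma center_adj_vertex_extends v B1 B2 b1 b2 p W1 W2 :
  separated v B1 B2 -> b1 \in B1 -> b2 \in B2 -> bipartitioned p p W1 W2 ->
  v -- p -> extends [set: G] p p W1 W2.
Proof.
move=> sep b1B b2B bip vp; have sep' := separated_sym sep.
have pN : p \in closed_nbrs v by rewrite in_closed_nbrs vp orbT.
have pB B B' : separated v B B' -> p \notin B.
  by move=> s; apply: contraL pN => /(sepN s).
have PN x : x \in [set p; p] -> x = p by rewrite !inE orbb => /eqP.
have vN : v \in edge_nbhd p p by rewrite in_edge_nbhd adj_sym vp orbT.
case: (boolP (B1 \subset edge_nbhd p p)) => [/subsetP B1N|/subsetPn[a aB aN]].
  by apply: (covered_extends sep b1B bip) => //; [eauto|eauto|move=> x /PN->].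
case: (boolP (B2 \subset edge_nbhd p p)) => [/subsetP B2N|/subsetPn[z zB zN]].
  by apply: (covered_extends sep' b2B bip) => //; [eauto|eauto|move=> x /PN->].
have compB := sep_component sep (p := p) aB.
have vpN : eq_or_adj v p by rewrite /eq_or_adj vp orbT.
have aN' : a \notin edge_nbhd v p.
  by rewrite in_setU (negbTE (sepN sep aB)) /=; apply: contra aN => aN; rewrite in_setU aN.
apply: (component_extends bip vpN aN' (z := z)).
- by move=> x /PN->; apply: contra (pB _ _ sep) => /compB.
- by move=> x /PN-> _; rewrite !inE eqxx orbT.
- by apply: contra (sep_notin sep zB).1 => /compB.
- by apply: contra (sep_notin sep zB).2; apply: touches_sub.
- have := sepN sep' zB; apply: contra; rewrite !inE => /orP[->//|/eqP->].
  by rewrite vp orbT.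
Qed.

(* Otherwise a part of B1 can be cut off by N[{p, q}]. *)
Lemma linking_path v B1 B2 b1 b2 p q W1 W2 :
  separated v B1 B2 -> b1 \in B1 -> b2 \in B2 -> bipartitioned p q W1 W2 ->
  v -- p -> v -- q ->
  extends [set: G] p q W1 W2 \/
  exists z s, [/\ ipath (z :: s), {in z :: s, forall x, v -- x /\ x \notin edge_nbhd p q},
    touches B1 z /\ {in s, forall x, ~~ touches B1 x}, touches B2 (last z s)
    & {in belast z s, forall x, ~~ touches B2 x}].
Proof.
move=> sep b1B b2B bip vp vq; have sep' := separated_sym sep.
have PN x : x \in [set p; q] -> x \in closed_nbrs v.
  by rewrite !inE => /orP[]/eqP->; rewrite ?vp ?vq orbT.
have PB B B' x : separated v B B' -> x \in [set p; q] -> x \notin B.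
  by move=> s /PN; apply: contraL => /(sepN s).
have pP : p \in [set p; q] by rewrite !inE eqxx.
have qP : q \in [set p; q] by rewrite !inE eqxx orbT.
have vN : v \in edge_nbhd p q by rewrite in_edge_nbhd adj_sym vp orbT.
case: (boolP (B1 \subset edge_nbhd p q)) => [/subsetP B1N|/subsetPn[e1 e1B e1N]].
  by left; apply: (covered_extends sep b1B bip) => //; eauto.
case: (boolP (B2 \subset edge_nbhd p q)) => [/subsetP B2N|/subsetPn[e2 e2B e2N]].
  by left; apply: (covered_extends sep' b2B bip) => //; eauto.
have [pq _ _] := bip.
set S := ~: edge_nbhd p q.
have e1S : e1 \in S by rewrite in_setC.
case: (boolP (linked S e1 e2)) => [/linkedP[s [ps ls sS]] | nl]; last first.
  left; apply: (component_extends bip pq e1N (z := e2)) => //.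
  - move=> x xP; apply: contraL (edge_sub_nbhd xP) => xC.
    by have := component_in e1S xC; rewrite in_setC.
  - by rewrite inE.
  - apply: contra nl => /touchesP[y yC xy].
    have yS := component_in e1S yC; rewrite inE in yC.
    by apply: linked_step yC yS _ _; rewrite ?in_setC // adj_sym.
  - by apply: contra e2N => /edge_sub_nbhd.
right.
(* The walk from [e1] to [e2] is cut between its last vertex [u] in [B1] and the next vertex [w] in
   [B2]; what lies strictly between them is in N(v). *)
have : has (mem B1) (e1 :: s) by rewrite /= e1B.
case/has_splitr => l [u [r [el /= uB /hasPn nr]]].
have lr : last u r = e2 by have := congr1 (last e1) el; rewrite last_cat /= => <-.
have psr : path (@adj G) u r.
  case: l el => [|e l] [eu es]; first by rewrite -es -eu.
  by move: ps; rewrite es cat_path => /and3P[].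
have rS : {in r, forall x, x \in S}.
  move=> x xr; have : x \in e1 :: s by rewrite el mem_cat inE xr !orbT.
  by rewrite inE => /predU1P[->|/sS[]].
have e2r : e2 \in r.
  have := mem_last u r; rewrite lr inE => /predU1P[eu|//].
  by have := (sep_notin sep e2B).1; rewrite eu uB.
have : has (mem B2) r by apply/hasP; exists e2.
case/has_splitl => m [w [r' [er /= wB /hasPn nm]]].
have mN x : x \in m -> v -- x.
  move=> xm; have : x \in closed_nbrs v.
    apply: contraT => /(sep_outside sep); rewrite (negbTE (nm x xm : x \notin B2)) orbF.
    by apply: contraLR => _; apply: nr; rewrite er mem_cat xm.
  have : x \in S by apply: rS; rewrite er mem_cat xm.
  by rewrite in_closed_nbrs in_setC => xS /predU1P[xv|//]; rewrite xv vN in xS.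
have mS x : x \in m -> x \notin edge_nbhd p q.
  by move=> xm; rewrite -in_setC; apply: rS; rewrite er mem_cat xm.
have pm : path (@adj G) u (rcons m w).
  by move: psr; rewrite er -cat_rcons cat_path => /andP[].
(* The parts are anticomplete, so [u] and [w] are not consecutive. *)
case: m pm mN mS {er nm} => [|z m] /= pm mN mS.
  case/andP: pm => uw _; have [_ _ anti] := sep.
  by have := anti _ _ uB wB; rewrite uw.
case/andP: pm => uz; rewrite rcons_path => /andP[pm lw].
have [t [ipt lt tm]] := walk_ipath pm.
have tz : touches B1 z by apply/touchesP; exists u; rewrite // adj_sym.
have tl : touches B2 (last z t) by apply/touchesP; exists w; rewrite ?lt.
have [y [s' [ips sub [ty nt] tl' nb]]] := ipath_sub ipt tz tl.
exists y, s'; split=> //.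
- move=> x /sub; rewrite inE => xt; have xm : x \in z :: m.
    by rewrite inE; case/predU1P: xt => [->|/tm->]; rewrite ?eqxx ?orbT.
  by split; [apply: mN | apply: mS].
- by split=> // x; apply: (hasPn nt).
- by move=> x; apply: (hasPn nb).
Qed.

(* Otherwise the component of u in G - N[{v, p}] can be cut off by N[{v, p}]. *)
Lemma attached_path v B1 B2 p q W1 W2 u z :
  separated v B1 B2 -> bipartitioned p q W1 W2 -> v -- p -> v -- q -> p -- q ->
  u \in B1 -> z -- u -> v -- z -> z \notin edge_nbhd p q ->
  extends [set: G] p q W1 W2 \/
  exists s, [/\ ipath (q :: rcons s z), {subset s <= B1} &
               {in s, forall x, x \notin closed_nbrs p}].
Proof.
move=> sep bip vp vq pq uB zu vz zN.
have := zN; rewrite in_edge_nbhd !negb_or => /and4P[zp npz zq nqz].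
(* An edge [p u] would complete the square [v z u p] and force the excluded edge [z p]. *)
have uN : u \notin edge_nbhd v p.
  rewrite in_setU (negbTE (sepN sep uB)) /= in_closed_nbrs negb_or; apply/andP; split.
    by apply: contraNneq npz => <-; rewrite adj_sym.
  apply: contra npz => pu; rewrite adj_sym.
  by apply: (sep_square sep uB _ vz vp pu zp); rewrite adj_sym.
have compB := sep_component sep (p := p) uB.
have vpN : eq_or_adj v p by rewrite /eq_or_adj vp orbT.
have PB x : x \in [set p; q] -> x \notin B1.
  move=> xP; apply/negP => /(sepN sep); apply/negP; rewrite negbK in_closed_nbrs.
  by move: xP; rewrite !inE => /orP[]/eqP->; rewrite ?vp ?vq orbT.
case: (boolP (touches (component (~: edge_nbhd v p) u) q)) => [/touchesP[a aC qa]|nt]; last first.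
  left; apply: (component_extends bip vpN uN (z := q)) => //.
  - by move=> x /PB; apply: contra => /compB.
  - move=> x; rewrite !inE => /orP[]/eqP->; first by rewrite eqxx orbT.
    by move=> tq; rewrite tq in nt.
  - by apply: contra (PB q _) => [/compB//|]; rewrite !inE eqxx orbT.
  - by rewrite !inE negb_or eq_sym (adj_neq vq) eq_sym (adj_neq pq).
right; have uS : u \in ~: edge_nbhd v p by rewrite in_setC.
have aS := component_in uS aC.
have ua : linked (~: edge_nbhd v p) u a by rewrite inE in aC.
(* The path from [q] to [z] runs through the component of [u], hence inside [B1] and away from
   N[p]. *)
have [||s ips sS] := @ipath_through (~: edge_nbhd v p) q z a u _ qa zu aS.
- by rewrite eq_sym.
- by rewrite linkedC.
exists s; split=> // x /sS[xS ax].
  by apply: compB; rewrite inE; apply: connect_trans ua ax.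
by move: xS; rewrite in_setC in_setU negb_or => /andP[].
Qed.

(** * The parity contradiction for an edge inside N(v) *)

Lemma ipath_rev s : ipath s -> ipath (rev s).
Proof.
case: s => // x0 s; move: (x0 :: s) => {}s ip.
have [us adjE] := (ipath_nth x0 s).1 ip.
apply/(ipath_nth x0); split=> [|i j]; first by rewrite rev_uniq.
rewrite size_rev => /andP[lt_ij lt_j]; have lt_i := ltn_trans lt_ij lt_j.
rewrite !nth_rev // adj_sym adjE; move: (size s) lt_i lt_j => n lt_i lt_j; lia.
Qed.

(** Closed up by [v], the path becomes a hole with [size s + 3] vertices, an odd number. *)
Lemma arc_parity v p z s B : p -- v -> v -- z -> ipath (p :: rcons s z) ->
  p != z -> ~~ (p -- z) -> {subset s <= B} -> {in B, forall x, x \notin closed_nbrs v} ->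
  ~~ odd (size s).
Proof.
move=> pv vz ips pz npz sB BN.
have s0 : s != [::].
  by apply: contraNneq npz => s0; move: ips; rewrite s0 /= => /andP[].
have ipv : ipath (z :: rcons [:: v] p).
  have [zv vp] : z -- v /\ v -- p by rewrite adj_sym vz adj_sym.
  rewrite /= zv vp !inE !negb_or (adj_neq zv) (adj_neq vp) eq_sym pz.
  by rewrite adj_sym npz.
have hc : is_hole (p :: s ++ z :: [:: v]).
  apply: hole_glue => // x y /sB xB; rewrite inE => /eqP->.
  by have := BN x xB; rewrite in_closed_nbrs negb_or adj_sym.
by have := EH hc; rewrite /= size_cat /= addn2 /= negbK.
Qed.

Lemma center_adj_edge_extends v B1 B2 b1 b2 p q W1 W2 :
  separated v B1 B2 -> b1 \in B1 -> b2 \in B2 -> bipartitioned p q W1 W2 ->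
  v -- p -> v -- q -> p -- q -> extends [set: G] p q W1 W2.
Proof.
move=> sep b1B b2B bip vp vq pq; have sep' := separated_sym sep.
case: (linking_path sep b1B b2B bip vp vq) => [//|[z [s [ipz zN [tz nt1] tl nt2]]]].
pose y := last z s; have ys : y \in z :: s := mem_last z s.
have [vz zNP] := zN z (mem_head z s); have [vy yNP] := zN y ys.
case/touchesP: (tz) => u uB zu; case/touchesP: (tl) => w wB yw.
have bip' := bipartitioned_sym bip; have qp : q -- p by rewrite adj_sym.
have zNP' : z \notin edge_nbhd q p by rewrite edge_nbhdC.
have yNP' : y \notin edge_nbhd q p by rewrite edge_nbhdC.
(* [r] joins [p] to [z] inside [B1] and avoids N[q]; [r1] and [r2] join [p] and [q] to [y] inside
   [B2], and [r2] avoids N[p]. *)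
case: (attached_path sep bip' vq vp qp uB zu vz zNP') => [/extends_sym//|[r [ipr rB rN]]].
case: (attached_path sep' bip' vq vp qp wB yw vy yNP') => [/extends_sym//|[r1 [ipr1 rB1 _]]].
case: (attached_path sep' bip vp vq pq wB yw vy yNP) => [//|[r2 [ipr2 rB2 rN2]]].
exfalso.
have NP x : x \in z :: s -> [/\ p != x, ~~ (p -- x), q != x & ~~ (q -- x)].
  case/zN => _; rewrite in_edge_nbhd !negb_or => /and4P[xp px xq qx].
  by rewrite eq_sym xp px eq_sym xq qx.
have [pz npz qz nqz] := NP z (mem_head z s); have [py npy qy nqy] := NP y ys.
have pv : p -- v by rewrite adj_sym.
have qv : q -- v by rewrite adj_sym.
have par := arc_parity pv vz ipr pz npz rB (sepN sep).
have par1 := arc_parity pv vy ipr1 py npy rB1 (sepN sep').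
have par2 := arc_parity qv vy ipr2 qy nqy rB2 (sepN sep').
have anti_pq x : x \in [set p; q] -> x \notin B1 /\ x \notin B2.
  move=> xP; have xN : x \in closed_nbrs v.
    by move: xP; rewrite !inE => /orP[]/eqP->; rewrite ?vp ?vq orbT.
  by split; apply: contraL xN; [apply: (sepN sep) | apply: (sepN sep')].
have [[pB1 pB2] [qB1 qB2]] : (p \notin B1 /\ p \notin B2) /\ (q \notin B1 /\ q \notin B2).
  by split; apply: anti_pq; rewrite !inE eqxx ?orbT.
have zsB x : x \in z :: s -> x \notin B1 /\ x \notin B2.
  case/zN => vx _; have xN : x \in closed_nbrs v by rewrite in_closed_nbrs vx orbT.
  by split; apply: contraL xN; [apply: (sepN sep) | apply: (sepN sep')].
have belast_zs x : x \in belast z s -> x \in z :: s.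
  by move=> xb; rewrite lastI mem_rcons inE xb orbT.
have anti_z (t : seq G) : {in t, forall x, x \in B2 \/ x \in [set p; q]} ->
    {in belast z s & t, forall x x', (x != x') && ~~ (x -- x')}.
  move=> tB x x' xb /tB[x'B|x'P].
    have [_ xB2] := zsB x (belast_zs x xb).
    rewrite (contraNneq _ xB2) => [|-> //] /=.
    by apply: contra (nt2 x xb) => xx'; apply/touchesP; exists x'.
  have [px npx qx nqx] := NP x (belast_zs x xb).
  move: x'P; rewrite !inE => /orP[]/eqP->; rewrite eq_sym adj_sym.
    by rewrite px npx.
  by rewrite qx nqx.
(* The path [z :: s] is prolonged beyond its end [y]: its earlier vertices have no neighbor in [B2]
   and are outside N[P]. *)
have join t x' : ipath (y :: rcons t x') -> {in rcons t x', forall x, x \in B2 \/ x \in [set p; q]} ->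
    ipath (z :: rcons (s ++ t) x').
  move=> ipt tB; rewrite rcons_cat -cat_cons lastI cat_rcons.
  apply: ipath_cat => //; first by rewrite -lastI.
  exact: anti_z.
have s1P t a : (s ++ rcons t a) != [::] by case: (s); case: (t).
have antir (t : seq G) : {in t, forall x, x \in B2} ->
    {in s ++ t & r, forall x x', (x != x') && ~~ (x -- x')}.
  move=> tB x x'; rewrite mem_cat => /orP[xs|/tB xB] /rB x'B.
    have [xB1 _] : x \notin B1 /\ x \notin B2 by apply: zsB; rewrite inE xs orbT.
    rewrite (contraNneq _ xB1) => [|-> //] /=.
    by apply: contra (nt1 x xs) => xx'; apply/touchesP; exists x'.
  have [xB1 nt] := sep_notin sep xB.
  rewrite (contraNneq _ xB1) => [|-> //] /=.
  by apply: contra nt => xx'; apply/touchesP; exists x'.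
have r0 : r != [::].
  by apply: contraNneq npz => r0; move: ipr; rewrite r0 /= => /andP[].
have r10 : r1 != [::].
  by apply: contraNneq npy => r10; move: ipr1; rewrite r10 /= => /andP[].
have rev_ip a t b : ipath (a :: rcons t b) -> ipath (b :: rcons (rev t) a).
  by move/ipath_rev; rewrite rev_cons rev_rcons.
have hA : is_hole (z :: (s ++ rev r1) ++ p :: r).
  apply: hole_glue => //.
  - apply: join; first exact: rev_ip.
    move=> x; rewrite mem_rcons inE mem_rev => /predU1P[->|/rB1]; last by left.
    by right; rewrite !inE eqxx.
  - rewrite -size_eq0 size_cat size_rev addn_eq0 size_eq0 size_eq0.
    by rewrite (negbTE r10) andbF.
  - by apply: antir => x; rewrite mem_rev => /rB1.
(* [p] can follow [q], as it is adjacent neither to [y] nor to [r2], which avoids N[p]. *)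
have ipB : ipath (y :: rcons (rcons (rev r2) q) p).
  rewrite -cats1 cat_rcons -cat_cons; apply: ipath_cat.
  - exact: rev_ip.
  - by rewrite /= qp inE (adj_neq qp).
  - move=> x x' xr; rewrite inE => /eqP->.
    rewrite eq_sym adj_sym; move: xr; rewrite inE mem_rev => /predU1P[->|/rN2].
      by rewrite py npy.
    by rewrite in_closed_nbrs negb_or eq_sym.
(* The detour over [q] creates no chord, because [r] avoids N[q]. *)
have hB : is_hole (z :: (s ++ rcons (rev r2) q) ++ p :: r).
  apply: hole_glue => //.
    apply: join => // x; rewrite mem_rcons inE mem_rcons inE mem_rev.
    by case/or3P => [/eqP->|/eqP->|/rB2]; [right|right|left] => //; rewrite !inE eqxx ?orbT.
  move=> x x'; rewrite -cats1 catA cats1 mem_rcons inE => /predU1P[->|xs] xr.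
    rewrite (contraNneq _ qB1) => [|-> //]; last exact: rB.
    by have := rN x' xr; rewrite in_closed_nbrs negb_or => /andP[].
  by apply: (antir (rev r2)) => // x0; rewrite mem_rev => /rB2.
(* The holes have |s| + |r1| + |r| + 2 and |s| + |r2| + |r| + 3 vertices, where |r|, |r1| and |r2|
   are even. *)
have := EH hA; have := EH hB.
rewrite /= !(size_cat, size_rcons, size_rev) /= !(addnS, addSn) /= !oddD.
by move: par par1 par2; do 3!case: (odd (size _)) => //; case: (odd _).
Qed.

(** Every position of P is covered: [v] in P, P meeting N(v), and P inside one of the two parts. *)
Lemma star_extends v B1 B2 b1 b2 p q W1 W2 :
  separated v B1 B2 -> b1 \in B1 -> b2 \in B2 -> bipartitioned p q W1 W2 ->
  extends [set: G] p q W1 W2.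
Proof.
move=> sep b1B b2B bip; have sep' := separated_sym sep.
case: (v =P p) bip => [<-|/eqP vp] bip; first exact: (center_in_extends sep b1B b2B).
case: (v =P q) bip => [<-|/eqP vq] bip.
  by apply/extends_sym/(center_in_extends sep b1B b2B)/bipartitioned_sym.
have center p' q' : bipartitioned p' q' W1 W2 -> v != q' -> v -- p' ->
    extends [set: G] p' q' W1 W2.
  move=> bip' vq' vp'; have [pq' _ _] := bip'.
  case: (boolP (q' \in closed_nbrs v)) => [|qN].
    rewrite in_closed_nbrs eq_sym (negbTE vq') /= => adj_vq.
    case/predU1P: pq' => [epq|adj_pq].
      by move: bip'; rewrite -epq => bip'; apply: (center_adj_vertex_extends sep b1B b2B).
    exact: (center_adj_edge_extends sep b1B b2B).
  case/orP: (sep_outside sep qN) => qB.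
    exact: (center_adj_far_extends sep b1B b2B).
  exact: (center_adj_far_extends sep' b2B b1B).
case: (boolP (v -- p)) => [/center|nvp]; first exact.
case: (boolP (v -- q)) => [adj_vq|nvq].
  by apply/extends_sym/center => //; apply: bipartitioned_sym.
(* P avoids N[v] and is connected, so it lies in one part, and [v] cuts off the other. *)
wlog pB : B1 B2 b1 b2 sep sep' b1B b2B {center} / p \in B1 => [hw|].
  have : p \notin closed_nbrs v by rewrite in_closed_nbrs eq_sym negb_or vp.
  by case/(sep_outside sep)/orP => pB; [apply: (hw B1 B2 b1 b2)|apply: (hw B2 B1 b2 b1)].
have [pB2 np] := sep_notin sep' pB.
have [pq _ _] := bip.
have qB : q \in B1.
  case/predU1P: pq => [<- //|pq]; have := sep_adj sep pB pq.
  by rewrite in_closed_nbrs eq_sym (negbTE vq) (negbTE nvq) !orbF.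
have [qB2 nq] := sep_notin sep' qB.
apply: (center_extends sep' b2B b1B bip) => // x.
by rewrite !inE => /orP[]/eqP->; [rewrite (negbTE np)|rewrite (negbTE nq)].
Qed.

End StarCutset.
End Free.

(** * Induced subgraphs *)

(** Leads from the encoding by pairs back to the sequences in [weakly_FPE]. *)
Definition edge_seq u w := if u == w then [:: u] else [:: u; w].

Lemma mem_edge_seq u w x : (x \in edge_seq u w) = (x \in [set u; w]).
Proof. by rewrite /edge_seq; case: (u =P w) => [->|_]; rewrite !inE ?orbb. Qed.

Lemma set_edge_seq u w : [set x in edge_seq u w] = [set u; w].
Proof. by apply/setP => x; rewrite inE mem_edge_seq. Qed.

Lemma path_nbhd_edge_seq u w : path_nbhd (edge_seq u w) = edge_nbhd u w.
Proof.
apply/setP => x; rewrite inE mem_edge_seq in_edge_nbhd.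
apply/idP/idP => [/orP[|/existsP[y /andP[]]]|].
- by rewrite !inE => /orP[]->; rewrite ?orbT.
- by rewrite mem_edge_seq !inE adj_sym => /orP[]/eqP-> ->; rewrite ?orbT.
case/or4P => [xu|ux|xw|wx]; try by rewrite !inE ?xu ?xw ?orbT.
  by apply/orP; right; apply/existsP; exists u; rewrite mem_edge_seq !inE eqxx adj_sym.
by apply/orP; right; apply/existsP; exists w; rewrite mem_edge_seq !inE eqxx orbT adj_sym.
Qed.

Lemma is_path_edge_seq u w : eq_or_adj u w -> is_path (edge_seq u w).
Proof.
move=> uw; apply: ipath_is_path; first by rewrite /edge_seq; case: (u == w).
by move: uw; rewrite /edge_seq /eq_or_adj; case: (u =P w) => //= /eqP nuw ->; rewrite inE nuw.
Qed.

Lemma size_edge_seq u w : size (edge_seq u w) = 1 \/ size (edge_seq u w) = 2.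
Proof. by rewrite /edge_seq; case: eqP; [left | right]. Qed.

Lemma edge_seqP s : is_path s -> size s = 1 \/ size s = 2 ->
  exists u w, eq_or_adj u w /\ s = edge_seq u w.
Proof.
case: s => [|u [|w [|x s]]] [_ us adjE]; try by case.
  by move=> _; exists u, u; rewrite /eq_or_adj /edge_seq eqxx.
move=> _; have /negbTE nuw : u != w by move: us; rewrite /= inE => /andP[].
exists u, w; rewrite /eq_or_adj /edge_seq nuw adjE ?inE ?eqxx ?orbT //=.
by rewrite !eqxx nuw.
Qed.

End InducedPaths.

Section InducedSubgraph.
Variables (G : sgraph) (S : {set G}).
Implicit Types (c s : seq G) (W : {set G}).

Lemma hole_map_val (c' : seq (induced S)) : is_hole (map val c' : seq G) <-> is_hole c'.
Proof.
split=> [] [c3 uc adjE].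
  rewrite size_map in c3; rewrite (map_inj_uniq val_inj) in uc.
  split=> // x y xc yc; have := adjE _ _ (map_f val xc) (map_f val yc).
  by rewrite !(next_map val_inj) // !(inj_eq val_inj).
split; rewrite ?size_map ?(map_inj_uniq val_inj) //.
move=> _ _ /mapP[x xc ->] /mapP[y yc ->].
by rewrite !(next_map val_inj) // !(inj_eq val_inj) -adjE.
Qed.

Lemma lift_seq s : {subset s <= S} -> exists s' : seq (induced S), s = map val s'.
Proof.
elim: s => [|x s IH] sub; first by exists [::].
case: IH => [y ys|s' ->]; first by apply: sub; rewrite inE ys orbT.
have xS : x \in S by apply: sub; rewrite inE eqxx.
by exists ((Sub x xS : induced S) :: s').
Qed.

Lemma chordal_induced : chordal (induced S) <-> chordal_on S.
Proof.
split=> ch c hc; last first.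
  apply: (ch (map val c)); first exact/hole_map_val.
  by move=> _ /mapP[x _ ->]; apply: valP.
by move=> /lift_seq[c' ec]; apply: (ch c'); apply/hole_map_val; rewrite -ec.
Qed.

Lemma connect_induced (x y : induced S) :
  linked S (val x) (val y) -> connect (@adj (induced S)) x y.
Proof.
case/linkedP => s [ps ls sS].
have [|s' es] := @lift_seq s; first by move=> z /sS[].
rewrite {}es in ps ls {sS}; apply/connectP; exists s'; first by rewrite path_map in ps.
by apply: val_inj; rewrite -ls last_map.
Qed.

End InducedSubgraph.

(** Both sides of the prescribed partition are chordal by [chordal_edge_nbhd], so [weakly_FPE]
    applies to their preimages in the subgraph, and its answer is carried back along [val]. *)
Lemma weakly_FPE_extendable (G : sgraph) (S : {set G}) :
  even_hole_free G -> sector_wheel_free G -> weakly_FPE (induced S) -> extendable S.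
Proof.
move=> EH SW fpe u w W1 W2 uS wS uw WI WU.
pose u' : induced S := Sub u uS; pose w' : induced S := Sub w wS.
pose V (W : {set G}) := [set x : induced S | val x \in W].
have chV (W : {set G}) : W \subset W1 :|: W2 -> chordal (induced (V W)).
  rewrite WU subsetI => /andP[/subsetP WN _].
  apply/chordal_induced => c /hole_map_val hc cW.
  apply: (chordal_edge_nbhd EH SW uw hc) => _ /mapP[x /cW xW ->].
  by apply: WN; rewrite inE in xW.
have uw' : eq_or_adj u' w' by rewrite /eq_or_adj -(inj_eq val_inj).
have [||||X1 [X2 [[WX1 WX2] /chordal_induced cX1 /chordal_induced cX2 XI XU]]] :=
  fpe (edge_seq u' w') (V W1) (V W2) (is_path_edge_seq uw') (size_edge_seq u' w').
- by apply: chV; apply: subsetUl.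
- by apply: chV; apply: subsetUr.
- rewrite set_edge_seq; apply/setP => x.
  by rewrite !inE (in_setI_eq (val x) WI) !inE -!(inj_eq val_inj).
- rewrite path_nbhd_edge_seq; apply/setP => x.
  by rewrite !inE (in_setU_eq (val x) WU) !inE -!(inj_eq val_inj) (valP x) andbT.
pose I (X : {set induced S}) : {set G} := val @: X.
have inI X (x : induced S) : (val x \in I X) = (x \in X) by apply: mem_imset val_inj.
have IS X x : x \in I X -> x \in S by case/imsetP => y _ ->; apply: valP.
have subI (W : {set G}) (X : {set induced S}) : W \subset W1 :|: W2 -> V W \subset X -> W \subset I X.
  rewrite WU => /subsetP WS /subsetP VX; apply/subsetP => x xW.
  have := WS x xW; rewrite inE => /andP[_ xS].
  by rewrite -[x]/(val (Sub x xS : induced S)) inI VX // inE.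
have chI (X : {set induced S}) : chordal_on X -> chordal_on (I X).
  move=> cX c hc cI; have [c' ec] : exists c' : seq (induced S), c = map val c'.
    by apply: lift_seq => x /cI /IS.
  rewrite {}ec in hc cI; apply: (cX c'); first exact/hole_map_val.
  by move=> x xc; rewrite -inI; apply/cI/map_f.
exists (I X1), (I X2); split; try exact: chI.
- by split; apply: subI; rewrite ?subsetUl ?subsetUr.
- apply/setP => x; rewrite inE.
  case: (boolP (x \in S)) => xS.
    rewrite -[x]/(val (Sub x xS : induced S)) !inI (in_setI_eq _ XI).
    by rewrite inE mem_edge_seq !inE -!(inj_eq val_inj).
  rewrite (contraNF (@IS X1 x) xS); apply/esym; apply: contraNF xS.
  by rewrite !inE => /orP[]/eqP->.
- apply/setP => x; rewrite inE.
  case: (boolP (x \in S)) => xS.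
    by rewrite -[x]/(val (Sub x xS : induced S)) !inI (in_setU_eq _ XU) inE.
  by rewrite (contraNF (@IS X1 x) xS) (contraNF (@IS X2 x) xS).
Qed.

(** Of two vertices disconnected in G - C, one cannot reach G - N[v], which is connected and
    disjoint from [C]. That vertex lies in N(v), and its neighbors, in [C] or not, lie in N[v]. *)
Lemma star_cutset_split (G : sgraph) (v : G) (C : {set G}) :
  v \in C -> C \subset closed_nbrs v -> ~ connected_graph (induced (~: C)) ->
  {in ~: closed_nbrs v &, forall x y, linked (~: closed_nbrs v) x y} ->
  exists b, v -- b /\ forall y, b -- y -> y \in closed_nbrs v.
Proof.
move=> vC /subsetP CN ndis conn; set D := ~: closed_nbrs v.
have [x [y nxy]] : exists x y : induced (~: C), ~~ connect (@adj _) x y.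
  case: (boolP [exists x : induced (~: C), [exists y, ~~ connect (@adj _) x y]]).
    by case/existsP => x /existsP[y]; exists x, y.
  move/existsPn => all_conn; case: ndis => x y.
  by have /existsPn/(_ y)/negPn := all_conn x.
have sym : connect_sym (@adj (induced (~: C))).
  by apply: sym_connect_sym => a b; apply: adj_sym.
have dom (a : induced (~: C)) : (forall d, val d \in D -> ~~ connect (@adj _) a d) ->
    exists b, v -- b /\ forall z, b -- z -> z \in closed_nbrs v.
  move=> nD; have aC : val a \notin C by have := valP a; rewrite in_setC.
  exists (val a); split.
    have : val a \in closed_nbrs v.
      by apply: contraT => aN; have := nD a; rewrite in_setC aN connect0 => /(_ isT).
    by rewrite in_closed_nbrs => /predU1P[av|//]; rewrite av vC in aC.
  move=> z az; case: (boolP (z \in C)) => [/CN //|zC].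
  have zC' : z \in ~: C by rewrite in_setC.
  apply: contraT => zN; have := nD (Sub z zC' : induced (~: C)).
  by rewrite SubK in_setC zN (connect1 (_ : adj a _)) => [/(_ isT)|].
case: (boolP [exists d : induced (~: C), (val d \in D) && connect (@adj _) x d]); last first.
  by move/existsPn => nx; apply: (dom x) => d dD; have := nx d; rewrite dD.
case/existsP => d1 /andP[d1D xd1].
case: (boolP [exists d : induced (~: C), (val d \in D) && connect (@adj _) y d]); last first.
  by move/existsPn => ny; apply: (dom y) => d dD; have := ny d; rewrite dD.
case/existsP => d2 /andP[d2D yd2].
case/negP: nxy; apply: (connect_trans xd1); rewrite sym; apply: (connect_trans yd2).
apply: connect_induced; have := conn _ _ d2D d1D; apply: connect_sub => a b /and3P[aD bD ab].
have DC z : z \in D -> z \in ~: C by rewrite !in_setC; apply: contra => /CN.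
by apply: connect1; rewrite /= !DC.
Qed.

Theorem theorem5p8 (G : sgraph) :
  minimal_non_weakly_FPE G ->
  even_hole_free G ->
  sector_wheel_free G ->
  ~ has_star_cutset G.
Proof.
move=> [nFPE minFPE] EH SW [_ [v [C [vC CN ndis]]]]; apply: nFPE => s W1 W2 ps sz _ _ WI WU.
have minG (S : {set G}) : S \proper [set: G] -> extendable S.
  by move/minFPE; apply: weakly_FPE_extendable.
have [u [w [uw es]]] := edge_seqP ps sz.
rewrite es in WI WU *; rewrite set_edge_seq in WI *; rewrite path_nbhd_edge_seq in WU.
suff [X1 [X2 [WX cX1 cX2 XI XU]]] : extends [set: G] u w W1 W2.
  by exists X1, X2; split=> //; apply/chordal_induced.
set D := ~: closed_nbrs v.
case: (boolP [forall x in D, forall y in D, linked D x y]) => [conn|].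
  have conn' : {in D &, forall x y, linked D x y}.
    by move=> x y xD yD; move/forall_inP: conn => /(_ x xD)/forall_inP/(_ y yD).
  have [b [vb bv]] := star_cutset_split vC CN ndis conn'.
  exact: (dominated_vertex_extends SW minG uw WI WU vb bv conn').
case/forall_inPn => e1 e1D /forall_inPn[e2 e2D nl].
(* As [e2] is not linked to [e1] in [D], it witnesses that the remainder [B2] is nonempty. *)
pose B1 := component D e1; pose B2 := D :\: B1.
have B1D x : x \in B1 -> x \in D by apply: component_in.
have sep : separated v B1 B2.
  split.
  - apply/setP => x; rewrite in_setU in_setD -/D.
    by case: (boolP (x \in B1)) => //= /B1D->.
  - by rewrite disjoint_subset; apply/subsetP => x xB; rewrite !inE in xB *; rewrite xB.
  - move=> x y xB; rewrite in_setD => /andP[+ yD]; apply: contra => xy.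
    by move: (xB); rewrite !inE => e1x; apply: linked_step e1x (B1D x xB) yD xy.
apply: (star_extends EH SW minG sep (b1 := e1) (b2 := e2)) => //.
  by rewrite inE; apply: connect0.
by rewrite in_setD e2D andbT inE.
Qed.
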